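(* Let $\zeta\in(0,1)$, $c>0$, $x_0\in\mathbb{X}$, let $P^*$ be a diffuse probability measure on $\mathbb{X}$, and set $P_0=\zeta\delta_{x_0}+(1-\zeta)P^*$. Let $\tilde P\sim\mathrm{hNRMI}(\rho;c,P_0)$ and, for $n\ge1$, let $X_1,\dots,X_n$ be conditionally i.i.d. from $\tilde P$ given $\tilde P$. Then for all positive integers $k$ and $n_1,\dots,n_k$ with $n_1+\cdots+n_k=n$, the exchangeable partition probability function (EPPF) induced by $\tilde P$ is $$\Pi_k^{(n)}(n_1,\dots,n_k;\zeta)=\frac{1}{\Gamma(n)}\Big\{c^k(1-\zeta)^k\int_0^\infty u^{n-1}e^{-c\psi(u)}\prod_{m=1}^k\tau_{n_m}(u)\,du$$ $$\qquad+\,c^{k-1}(1-\zeta)^{k-1}\sum_{l=1}^k\sum_{i=1}^{n_l}c^i\zeta^i\int_0^\infty u^{n-1}e^{-c\psi(u)}\,\xi_{n_l,i}(u)\prod_{m\ne l}\tau_{n_m}(u)\,du\Big\},$$ where $\prod_{m\neq l}\tau_{n_m}(u)\equiv1$ when $k=1$.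
   Context: $\mathbb{X}$ is a Polish space with its Borel $\sigma$-algebra. A completely random measure (CRM) on $\mathbb{X}$ is a random measure $\tilde\mu$ such that $\tilde\mu(A_1),\dots,\tilde\mu(A_k)$ are mutually independent for all pairwise disjoint measurable $A_1,\dots,A_k$. Let $\rho:(0,\infty)\to[0,\infty)$ be measurable with $\int_0^\infty\min(1,s)\rho(s)\,ds<\infty$ and $\int_0^\infty\rho(s)\,ds=\infty$. For $c>0$ and a probability measure $H$ on $\mathbb{X}$, let $\tilde\mu$ be the (homogeneous, almost surely finite) CRM with Lévy intensity $\rho(s)\,ds\,c\,H(dx)$, i.e. for every measurable $g:\mathbb{X}\to[0,\infty)$, $$\mathbb{E}\Big[e^{-\int g\,d\tilde\mu}\Big]=\exp\Big\{-c\int_{\mathbb{X}}\int_0^\infty(1-e^{-sg(x)})\rho(s)\,ds\,H(dx)\Big\}.$$ $\mathrm{hNRMI}(\rho;c,H)$ denotes the law of the random probability measure $\tilde\mu/\tilde\mu(\mathbb{X})$. For $u>0$ and integer $q\ge1$: $\tau_q(u)=\int_0^\infty s^q e^{-us}\rho(s)\,ds$, $\psi(u)=\int_0^\infty(1-e^{-us})\rho(s)\,ds$, and for integers $1\le i\le n$, $$\xi_{n,i}(u)=\frac1{i!}\sum_{j=0}^i(-1)^{n-j}\binom ij\psi^{i-j}(u)\frac{d^n}{du^n}\big[\psi^j(u)\big].$$ The EPPF $\Pi_k^{(n)}(n_1,\dots,n_k;\zeta)$ is the probability that the random partition of $\{1,\dots,n\}$ generated by ties in $(X_1,\dots,X_n)$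 ($a$ and $b$ in the same block iff $X_a=X_b$) equals a given partition into $k$ blocks with sizes $n_1,\dots,n_k$ (whether or not one of the blocks corresponds to the value $x_0$). *)

(* Defs.v *)
From HB Require Import structures.
From mathcomp Require Import all_boot all_order all_algebra.
From mathcomp Require Import all_classical all_reals all_analysis.
From mathcomp Require Import measurable_realfun.

Set Implicit Arguments.
Unset Strict Implicit.
Unset Printing Implicit Defensive.

Import Order.TTheory GRing.Theory Num.Theory.
Import numFieldNormedType.Exports.

Local Open Scope classical_set_scope.
Local Open Scope ring_scope.

Definition metrizes (R : realType) (X : topologicalType) (dist : X -> X -> R)
    : Prop :=
  [/\ forall x y, 0 <= dist x y,
      forall x y, dist x y = 0 <-> x = y,
      forall x y, dist x y = dist y x,
      forall x y z, dist x z <= dist x y + dist y z &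
      forall x (A : set X),
        nbhs x A <-> exists2 e, 0 < e & [set y | dist x y < e] `<=` A].

Definition complete_distance (R : realType) (X : topologicalType)
    (dist : X -> X -> R) : Prop :=
  forall v : nat -> X,
    (forall e, 0 < e -> exists N, forall p q, (N <= p)%N -> (N <= q)%N ->
       dist (v p) (v q) < e) ->
    exists l : X, v @ \oo --> l.

(* The metric is existentially quantified: a Polish space carries only a
   topology. *)
Definition polish (R : realType) (X : topologicalType) : Prop :=
  (exists2 D : set X, countable D & dense D) /\
  (exists2 dist : X -> X -> R, metrizes dist & complete_distance dist).

Notation borel X := (g_sigma_algebraType (@open X)).

(* Taking some of the B i equal to setT gives the product rule for all
   subfamilies. *)
Definition mutually_independent (R : realType) d (Omega : measurableType d)
    (P : probability Omega R) (k : nat) (Y : 'I_k -> Omega -> \bar R) : Prop :=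
  forall B : 'I_k -> set (\bar R), (forall i, measurable (B i)) ->
    P (\bigcap_(i in [set: 'I_k]) (Y i @^-1` B i)) =
    (\prod_(i < k) P (Y i @^-1` B i))%E.

Definition completely_random (R : realType) (X : ptopologicalType)
    d (Omega : measurableType d) (P : probability Omega R)
    (mu : R.-ker Omega ~> borel X) : Prop :=
  forall (k : nat) (A : 'I_k -> set (borel X)),
    (forall i, measurable (A i)) -> trivIset [set: 'I_k] A ->
    mutually_independent P (fun i w => mu w (A i)).

(* The Laplace functional for the Levy intensity rho(s) ds c H(dx); the
   integrals may be infinite, with expeR -oo = 0. *)
Definition has_levy_intensity (R : realType) (X : ptopologicalType)
    d (Omega : measurableType d) (P : probability Omega R)
    (mu : R.-ker Omega ~> borel X)
    (rho : R -> R) (c : R) (H : probability (borel X) R) : Prop :=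
  forall g : borel X -> R, measurable_fun [set: borel X] g ->
    (forall x, 0 <= g x) ->
    (\int[P]_w expeR (- \int[mu w]_x (g x)%:E) =
     expeR (- (c%:E * \int[H]_x \int[lebesgue_measure]_(s in `]0%R, +oo[)
                        ((1 - expR (- (s * g x))) * rho s)%:E)))%E.

Definition homogeneous_CRM (R : realType) (X : ptopologicalType)
    d (Omega : measurableType d) (P : probability Omega R)
    (mu : R.-ker Omega ~> borel X)
    (rho : R -> R) (c : R) (H : probability (borel X) R) : Prop :=
  [/\ completely_random P mu,
      {ae P, forall w, (mu w [set: borel X] < +oo)%E} &
      has_levy_intensity P mu rho c H].

(* [mnormalize m point] is m / m(X) when 0 < m(X) < +oo.  The default value
   [point] taken otherwise does not matter: when rho is not integrable, the
   total mass of the CRM is almost surely positive and finite. *)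
Definition hNRMI (R : realType) (X : ptopologicalType)
    (rho : R -> R) (c : R) (H : probability (borel X) R)
    (L : probability (pprobability (borel X) R) R) : Prop :=
  exists d (Omega : measurableType d) (P : probability Omega R)
      (mu : R.-ker Omega ~> borel X),
    homogeneous_CRM P mu rho c H /\
    forall B : set (pprobability (borel X) R), measurable B ->
      L B = P ((fun w => mnormalize (mu w) point : pprobability (borel X) R)
                 @^-1` B).

(* f is a version of the conditional probability P(E | G). *)
Definition is_conditional_probability (R : realType) d
    (Omega : measurableType d) (P : probability Omega R)
    (G : set (set Omega)) (E : set Omega) (f : Omega -> \bar R) : Prop :=
  (forall B : set (\bar R), measurable B -> G (f @^-1` B)) /\
  (forall F : set Omega, G F -> P (E `&` F) = (\int[P]_(w in F) f w)%E).

Definition conditionally_iid (R : realType) (X : ptopologicalType)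
    d (Omega : measurableType d) (P : probability Omega R)
    (Pt : Omega -> pprobability (borel X) R)
    (n : nat) (Y : 'I_n -> Omega -> borel X) : Prop :=
  forall A : 'I_n -> set (borel X), (forall a, measurable (A a)) ->
    is_conditional_probability P (preimage_set_system [set: Omega] Pt measurable)
      (\bigcap_(a in [set: 'I_n]) (Y a @^-1` A a))
      (fun w => \prod_(a < n) Pt w (A a))%E.

Definition tie_partition (X : eqType) (n : nat) (y : 'I_n -> X)
    : {set {set 'I_n}} :=
  equivalence_partition (fun a b => y a == y b) [set: 'I_n]%SET.

Section special_functions.
Variable R : realType.

Definition Gamma (a : R) : R :=
  \int[lebesgue_measure]_(t in `]0%R, +oo[) (t `^ (a - 1) * expR (- t)).

Definition tau (rho : R -> R) (q : nat) (u : R) : R :=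
  \int[lebesgue_measure]_(s in `]0%R, +oo[) (s ^+ q * expR (- (u * s)) * rho s).

Definition psi (rho : R -> R) (u : R) : R :=
  \int[lebesgue_measure]_(s in `]0%R, +oo[) ((1 - expR (- (u * s))) * rho s).

Definition xi (rho : R -> R) (n i : nat) (u : R) : R :=
  (i`!)%:R^-1 * \sum_(0 <= j < i.+1)
    (-1) ^+ (n - j) * 'C(i, j)%:R * psi rho u ^+ (i - j)
      * derive1n n (fun v : R => psi rho v ^+ j) u.

End special_functions.

(* Main.v *)
(* Cut the space by the first N sets of a countable point-separating family of
   open sets, keeping x0 as a cell of its own.  The Laplace functional makes the
   masses of the cells independent with transforms exp (- c P0(A) psi), whose
   derivatives are the partial Bell polynomials xi; together with
   T ^ -n = Gamma(n)^-1 * int u^(n-1) e^(-uT) du this gives the mixed moments of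
   the normalized masses.  The probability that the cells of X_1, ..., X_n are
   tied exactly as prescribed is a sum of such moments over the injective
   assignments of cells to blocks.

   As N grows, cell ties become ties.  Since P^* is diffuse, the sum of the
   squares of the P^*-masses q of the cells tends to 0, so in the sum over
   injective assignments only two kinds of terms survive: either no block sits at
   x0, and every block contributes (1 - zeta) c tau by linearization in q, or
   exactly one block l does, and it contributes the full polynomial
   sum_i (c zeta)^i xi_(n_l, i).  Dominated convergence, the dominating function
   being controlled by a single term of one of the finite sums, lets the limit
   pass under the integral in u. *)

Require Import Defs.
From HB Require Import structures.
From mathcomp Require Import all_boot all_order all_algebra.
From mathcomp Require Import all_classical all_reals all_analysis.
From mathcomp Require Import measurable_realfun ring lra.

Set Implicit Arguments.
Unset Strict Implicit.
Unset Printing Implicit Defensive.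

Import Order.TTheory GRing.Theory Num.Theory.
Import numFieldNormedType.Exports.

Local Open Scope classical_set_scope.
Local Open Scope ring_scope.

(** The definition of [xi] is an alternating sum, so its sign is not visible, yet every bound below
    rests on it. The recursion in [n] shows that, on [u > 0], [bell] is a polynomial in the [tau]
    with nonnegative coefficients. Hence for [n >= 1] the polynomial [bell_gen n a] in [a] has
    nonnegative coefficients, no constant term, linear coefficient [tau n] and degree at most [n].
    These facts drive the limit: scaling [a] by [y] in [0,1] gives [y * a * tau n] up to a multiple
    of [y ^ 2], and shrinks the value by no more than the factor [y ^ n]. The other obstacle is
    integrability in [u]. No growth estimate for [psi] at infinity is made. At each level the
    integral is, up to a positive constant, a probability, hence finite; the scaling bounds carry
    this finiteness over to the dominating function. For this reason the integrals are handled in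
    the extended reals until the limit is taken. *)

Lemma is_derive_expRN (R : realType) (a b z l : R) :
  is_derive l 1 (fun l => a + b * expR (- (l * z))) (- (b * z * expR (- (l * z)))).
Proof.
apply: is_derive_eq.
rewrite /GRing.scale /= /cst; ring.
Qed.

(** Differentiation under the integral on the window []l / 2, l + 1[]: as [Z >= 0], the derivative
    there is dominated by its value at [l / 2]. The summand [A] stays under the integral because for
    [psi] the two summands need not be integrable separately. *)
Lemma is_derive_Rintegral_expR (R : realType) d (T : measurableType d)
    (mu : {measure set T -> \bar R}) (D : set T) (A B Z : T -> R) :
  measurable D -> (forall t, D t -> 0 <= Z t) ->
  (forall l : R, 0 < l ->
     mu.-integrable D (EFin \o (fun t => A t + B t * expR (- (l * Z t))))) ->
  (forall l : R, 0 < l ->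
     mu.-integrable D (EFin \o (fun t => B t * Z t * expR (- (l * Z t))))) ->
  forall l : R, 0 < l ->
  is_derive l 1 (fun l => \int[mu]_(t in D) (A t + B t * expR (- (l * Z t))))
    (- \int[mu]_(t in D) (B t * Z t * expR (- (l * Z t)))).
Proof.
move=> mD Z0 intf intd l l0.
pose f (l : R) t := A t + B t * expR (- (l * Z t)).
have df (x : R) y : is_derive x 1 (f ^~ y) (- (B y * Z y * expR (- (x * Z y)))).
  exact: is_derive_expRN.
have l20 : 0 < l / 2 by rewrite divr_gt0.
have Il : (`]l / 2, l + 1[%classic : set R) l.
  by rewrite /= in_itv/=; apply/andP; split; lra.
have I0 x : (`]l / 2, l + 1[%classic : set R) x -> l / 2 < x.
  by rewrite /= in_itv/= => /andP[].
pose G t := `|B t * Z t * expR (- (l / 2 * Z t))|.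
have G0 y : 0 <= G y by exact: normr_ge0.
have intG : mu.-integrable D (EFin \o G) by apply: integrable_norm; exact: intd.
have dF x y : partial1of2 f x y = - (B y * Z y * expR (- (x * Z y))).
  by rewrite partial1of2E derive_val.
have G_ub x y : (`]l / 2, l + 1[%classic : set R) x -> D y -> `|partial1of2 f x y| <= G y.
  move=> /I0 lx Dy; rewrite dF normrN /G !normrM ler_wpM2l//.
  rewrite !ger0_norm ?expR_ge0// ler_expR lerN2 ler_wpM2r//; first exact: Z0.
  exact: ltW.
have intf' x : (`]l / 2, l + 1[%classic : set R) x -> mu.-integrable D (EFin \o f x).
  by move=> /I0 lx; apply: intf; exact: lt_trans lx.
have derf x y : (`]l / 2, l + 1[%classic : set R) x -> D y -> derivable (f ^~ y) x 1.
  by move=> _ _; apply: ex_derive; exact: df.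
apply: DeriveDef.
  exact: (@derivable_under_integral _ _ _ mu f D mD l (l/2) (l+1) Il intf' derf G G0 intG G_ub).
rewrite -derive1E (differentiation_under_integral mD Il intf' derf _ intG)//.
rewrite (_ : (fun _ => _) = (fun t => (-1) * (B t * Z t * expR (- (l * Z t))))).
  by rewrite RintegralZl ?mulN1r//; exact: intd.
by apply/funext => y; rewrite dF mulN1r.
Qed.

(** * The Laplace exponent and its Bell polynomials *)

Section levy_density.
Context {R : realType} (rho : R -> R).
Hypothesis rho_meas : measurable_fun (`]0, +oo[%classic : set R) rho.
Hypothesis rho_ge0 : forall s, 0 < s -> 0 <= rho s.
Hypothesis rho_fin : (\int[lebesgue_measure]_(s in `]0%R, +oo[)
                  (Num.min 1 s * rho s)%:E < +oo)%E.

Local Notation D := (`]0, +oo[%classic : set R).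
Local Notation leb := (@lebesgue_measure R).

Lemma measurable_pos : measurable D.
Proof. exact: measurable_itv. Qed.

Lemma posP (s : R) : D s -> 0 < s.
Proof. by rewrite /= in_itv/= andbT. Qed.

Lemma measurable_expRN (Z : R -> R) (E : set R) (u : R) :
  measurable_fun E Z -> measurable_fun E (fun s => expR (- (u * Z s))).
Proof.
move=> mZ; apply: measurableT_comp => //; apply: measurableT_comp => //.
exact: measurable_funM.
Qed.

Lemma integrable_min1 : leb.-integrable D (fun s => (Num.min 1 s * rho s)%:E).
Proof.
apply/integrableP; split.
  apply/measurable_EFinP/measurable_funM => //; apply: measurable_funTS.
  exact: measurable_minr.
apply: le_lt_trans rho_fin; rewrite le_eqVlt; apply/orP; left; apply/eqP.
apply: eq_integral => s; rewrite inE => /posP s0.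
by rewrite gee0_abs// lee_fin mulr_ge0 ?rho_ge0// le_min ler01 ltW.
Qed.

(** The integrability given is that of [min 1 s * rho s], so every integrand is compared with a
    multiple of it. *)
Lemma integrable_dom (C : R) (f : R -> R) : measurable_fun D f ->
  (forall s, 0 < s -> `|f s| <= C * Num.min 1 s) ->
  leb.-integrable D (EFin \o (fun s => f s * rho s)).
Proof.
move=> mf fC; have C0 : 0 <= C.
  by have := le_trans (normr_ge0 _) (fC 1 ltr01); rewrite minxx mulr1.
apply: (@le_integrable _ _ _ leb D measurable_pos _ (fun s => (C%:E * (Num.min 1 s * rho s)%:E)%E)).
- exact/measurable_EFinP/measurable_funM.
- move=> s /posP s0; rewrite /= !lee_fin normrM [leRHS]ger0_norm.
    by rewrite mulrA (ger0_norm (rho_ge0 s0)) ler_wpM2r// ?rho_ge0// fC.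
  by rewrite !mulr_ge0 ?rho_ge0// le_min ler01 ltW.
- by apply: integrableZl; [exact: measurable_pos|exact: integrable_min1].
Qed.

Lemma integrable_psi u : 0 <= u ->
  leb.-integrable D (EFin \o (fun s => (1 - expR (- (u * s))) * rho s)).
Proof.
(* [1 - exp (- u s) <= min 1 (u s) <= (1 + u) min 1 s]. *)
move=> u0; apply: (@integrable_dom (1 + u)).
  by apply: measurable_funB => //; exact: measurable_expRN.
move=> s s0; have us0 : 0 <= u * s by rewrite mulr_ge0// ltW.
have e1 : 0 < expR (- (u * s)) by exact: expR_gt0.
rewrite ger0_norm; last by rewrite subr_ge0 expR_le1 oppr_le0.
have := expR_ge1Dx (- (u * s)).
rewrite /Num.min; case: ifPn => [s1|/negPf]; first by lra.
rewrite ltNge => /negbFE s1; nra.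
Qed.

Lemma integrable_tau q u : 0 < u ->
  leb.-integrable D (EFin \o (fun s => s ^+ q.+1 * expR (- (u * s)) * rho s)).
Proof.
(* [K] bounds [s ^ q.+1 * exp (- u s)], by [x ^ n / n! <= exp x]. It serves for [s > 1]; for
   [s <= 1] one factor [s] suffices, which is why the exponent is a successor. *)
move=> u0; pose K := (q.+1)`!%:R / u ^+ q.+1 : R.
have K0 : 0 <= K by rewrite divr_ge0// exprn_ge0// ltW.
apply: (@integrable_dom (1 + K)).
  by apply: measurable_funM; [exact: measurable_funX|exact: measurable_expRN].
move=> s s0; have us0 : 0 <= u * s by rewrite mulr_ge0// ltW.
have e0 : 0 < expR (- (u * s)) by exact: expR_gt0.
rewrite ger0_norm; last by rewrite mulr_ge0 ?exprn_ge0 ?ltW.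
rewrite /Num.min; case: ifPn => [s1|].
  rewrite mulr1; apply: (@le_trans _ _ K); last by rewrite lerDr.
  rewrite expRN ler_pdivrMr ?expR_gt0// /K mulrAC ler_pdivlMr ?exprn_gt0//.
  rewrite -exprMn (mulrC s) -ler_pdivrMl ?ltr0n ?fact_gt0//.
  by have := expR_ge1Dxn q us0; lra.
rewrite -leNgt => s1.
apply: (@le_trans _ _ (s * 1)); last first.
  by rewrite mulr1 ler_peMl ?lerDl// ltW.
apply: ler_pM; [exact/exprn_ge0/ltW|exact: ltW| |].
  by rewrite exprS ler_piMr ?exprn_ile1// ltW.
by rewrite expR_le1 oppr_le0.
Qed.

Lemma psiE u : psi rho u =
  \int[leb]_(s in D) (rho s + - rho s * expR (- (u * s))).
Proof. by apply: eq_Rintegral => s _; ring. Qed.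

Lemma is_derive_psi (u : R) : 0 < u -> is_derive u 1 (psi rho) (tau rho 1 u).
Proof.
move=> u0.
have -> : psi rho = fun u => \int[leb]_(s in D) (rho s + - rho s * expR (- (u * s))).
  by apply/funext => v; exact: psiE.
apply: (is_derive_eq (f' := - \int[leb]_(s in D) (- rho s * s * expR (- (u * s))))).
  apply: is_derive_Rintegral_expR => //.
  - by move=> s /posP/ltW.
  - move=> l l0; apply: eq_integrable (integrable_psi (ltW l0)) => // s _ /=.
    by congr EFin; ring.
  - move=> l l0; have := integrableN (integrable_tau 0 l0).
    by apply: eq_integrable => // s _ /=; congr EFin; ring.
rewrite /tau -mulN1r -RintegralZl//.
  by apply: eq_Rintegral => s _; ring.
have := integrableN (integrable_tau 0 u0).
by apply: eq_integrable => // s _ /=; congr EFin; ring.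
Qed.

Lemma is_derive_tau q (u : R) : 0 < u ->
  is_derive u 1 (tau rho q.+1) (- tau rho q.+2 u).
Proof.
move=> u0.
have -> : tau rho q.+1 = fun u =>
    \int[leb]_(s in D) (0 + s ^+ q.+1 * rho s * expR (- (u * s))).
  by apply/funext => v; apply: eq_Rintegral => s _; ring.
apply: (is_derive_eq (f' :=
  - \int[leb]_(s in D) (s ^+ q.+1 * rho s * s * expR (- (u * s))))).
  apply: (@is_derive_Rintegral_expR _ _ _ leb D (fun=> 0)) => //.
  - by move=> s /posP/ltW.
  - move=> l l0; apply: eq_integrable (integrable_tau q l0) => // s _ /=.
    by congr EFin; ring.
  - move=> l l0; apply: eq_integrable (integrable_tau q.+1 l0) => // s _ /=.
    by congr EFin; rewrite [in LHS]exprSr; ring.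
by congr (- _); apply: eq_Rintegral => s _; rewrite [in RHS]exprSr; ring.
Qed.

Lemma tau_ge0 q u : 0 <= tau rho q u.
Proof.
apply: Rintegral_ge0 => s /posP s0.
by rewrite !mulr_ge0 ?expR_ge0 ?rho_ge0// exprn_ge0// ltW.
Qed.

Lemma psi_ge0 u : 0 <= u -> 0 <= psi rho u.
Proof.
move=> u0; apply: Rintegral_ge0 => s /posP s0.
rewrite mulr_ge0 ?rho_ge0// subr_ge0 expR_le1 oppr_le0 mulr_ge0//.
exact: ltW.
Qed.

Lemma is_derive_mul (f g : R -> R) (u df dg : R) :
  is_derive u 1 f df -> is_derive u 1 g dg ->
  is_derive u 1 (fun v => f v * g v) (f u * dg + g u * df).
Proof. by move=> hf hg; exact: is_deriveM. Qed.

Lemma is_derive_add (f g : R -> R) (u df dg : R) :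
  is_derive u 1 f df -> is_derive u 1 g dg ->
  is_derive u 1 (fun v => f v + g v) (df + dg).
Proof. by move=> hf hg; exact: is_deriveD. Qed.

Lemma is_derive_scale (c : R) (f : R -> R) (u df : R) :
  is_derive u 1 f df -> is_derive u 1 (fun v => c * f v) (c * df).
Proof. by move=> hf; apply: is_deriveZ. Qed.

Lemma is_derive_pow (f : R -> R) (u df : R) n :
  is_derive u 1 f df ->
  is_derive u 1 (fun v => f v ^+ n) (n%:R * f u ^+ n.-1 * df).
Proof.
move=> hf; have -> : (fun v => f v ^+ n) = f ^+ n; last exact: is_deriveX.
by apply/funext => v; rewrite fctE.
Qed.

Lemma is_derive_bigsum n (f : 'I_n -> R -> R) (u : R) (df : 'I_n -> R) :
  (forall i, is_derive u 1 (f i) (df i)) ->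
  is_derive u 1 (fun v => \sum_(i < n) f i v) (\sum_(i < n) df i).
Proof.
move=> hf; have -> : (fun v => \sum_(i < n) f i v) = \sum_(i < n) f i.
  by apply/funext => v; rewrite fct_sumE.
exact: is_derive_sum.
Qed.

(** The identities hold only on [u > 0]; since that set is open, agreement there transfers a
    derivative between total functions. *)
Lemma is_derive_pos (f g : R -> R) (u df : R) : 0 < u ->
  (forall v, 0 < v -> f v = g v) -> is_derive u 1 f df -> is_derive u 1 g df.
Proof.
move=> u0 fg; apply: near_eq_is_derive.
by near=> v; apply: fg; near: v; exact: lt_nbhsr.
Unshelve. all: by end_near. Qed.

Lemma is_derive_inj (f : R -> R) (u df dg : R) :
  is_derive u 1 f df -> is_derive u 1 f dg -> df = dg.
Proof. by move=> hf hg; rewrite -(derive_val (is_derive := hf)) derive_val. Qed.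

(** A class closed under differentiation on [u > 0] that contains the powers of [psi]. It certifies
    that all their iterated derivatives exist, without which [derive1n] carries no information. *)
Inductive smooth_alg : (R -> R) -> Prop :=
| smooth_cst c : smooth_alg (fun=> c)
| smooth_psi : smooth_alg (psi rho)
| smooth_tau q : smooth_alg (tau rho q.+1)
| smooth_add f g : smooth_alg f -> smooth_alg g -> smooth_alg (fun u => f u + g u)
| smooth_mul f g : smooth_alg f -> smooth_alg g -> smooth_alg (fun u => f u * g u).

Lemma smooth_alg_derive f : smooth_alg f ->
  exists2 g, smooth_alg g & forall u : R, 0 < u -> is_derive u 1 f (g u).
Proof.
elim=> {f} [c||q|f1 f2 _ [g1 sg1 h1] _ [g2 sg2 h2]|
    f1 f2 s1 [g1 sg1 h1] s2 [g2 sg2 h2]].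
- by exists (fun=> 0) => [|u _]; [exact: smooth_cst|exact: is_derive_cst].
- by exists (tau rho 1) => [|u u0]; [exact: smooth_tau|exact: is_derive_psi].
- exists (fun u => -1 * tau rho q.+2 u) => [|u u0].
    by apply: smooth_mul; [exact: smooth_cst|exact: smooth_tau].
  by rewrite mulN1r; exact: is_derive_tau.
- exists (fun u => g1 u + g2 u) => [|u u0]; first exact: smooth_add.
  by apply: is_derive_add; [exact: h1|exact: h2].
- exists (fun u => f1 u * g2 u + f2 u * g1 u) => [|u u0].
    by apply: smooth_add; exact: smooth_mul.
  by apply: is_derive_mul; [exact: h1|exact: h2].
Qed.

Lemma smooth_alg_derive1n f n : smooth_alg f ->
  exists2 g, smooth_alg g & forall u : R, 0 < u -> derive1n n f u = g u.
Proof.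
move=> sf; elim: n => [|n [g sg fg]]; first by exists f.
have [h sh gh] := smooth_alg_derive sg; exists h => // u u0.
rewrite derive1nS derive1E; apply: derive_val.
by apply: is_derive_pos (gh u u0) => // v v0; rewrite fg.
Qed.

Lemma smooth_psiX j : smooth_alg (fun u => psi rho u ^+ j).
Proof.
elim: j => [|j IH]; first exact: smooth_cst.
have -> : (fun u => psi rho u ^+ j.+1) = (fun u => psi rho u * psi rho u ^+ j).
  by apply/funext => u; rewrite exprS.
by apply: smooth_mul => //; exact: smooth_psi.
Qed.

Lemma is_derive_derive1n_psiX j n (u : R) : 0 < u ->
  is_derive u 1 (derive1n n (fun v => psi rho v ^+ j))
    (derive1n n.+1 (fun v => psi rho v ^+ j) u).
Proof.
move=> u0; have [g sg fg] := smooth_alg_derive1n n (smooth_psiX j).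
have [h sh gh] := smooth_alg_derive sg.
have d : is_derive u 1 (derive1n n (fun v => psi rho v ^+ j)) (h u).
  by apply: is_derive_pos (gh u u0) => // v v0; rewrite fg.
by rewrite derive1nS derive1E derive_val.
Qed.

(* The sign (-1) ^+ (n + j) agrees with that of xi when i <= n, and makes the
   recursion in n valid without that restriction. *)
Definition bell n i (u : R) : R :=
  (i`!)%:R^-1 * \sum_(j < i.+1) (-1) ^+ (n + j) * 'C(i, j)%:R *
    (psi rho u ^+ (i - j) * derive1n n (fun v => psi rho v ^+ j) u).

Lemma xi_bell n i u : (i <= n)%N -> xi rho n i u = bell n i u.
Proof.
move=> ile; rewrite /xi /bell big_mkord; congr (_ * _).
apply: eq_bigr => j _; rewrite mulrA; congr (_ * _ * _ * _).
have jn : (j <= n)%N by rewrite (leq_trans _ ile)// -ltnS.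
by rewrite -signr_odd oddB// -oddD signr_odd.
Qed.

(** Product rule. Differentiating [psi ^ (i - j)] brings out [tau 1], the derivative of [psi], and
    [(i - j) C(i, j) / i! = C(i - 1, j) / (i - 1)!] turns that part into [bell n (i - 1)].
    Differentiating the other factor gives [bell n.+1 i] with the sign reversed. *)
Lemma is_derive_bell n i (u : R) : 0 < u ->
  is_derive u 1 (bell n i)
    ((if i is i'.+1 then tau rho 1 u * bell n i' u else 0) - bell n.+1 i u).
Proof.
move=> u0.
have hpsi := is_derive_psi u0.
have hd := is_derive_scale (i`!)%:R^-1 (is_derive_bigsum (fun j : 'I_i.+1 =>
  is_derive_scale ((-1) ^+ (n + j) * 'C(i, j)%:R) (is_derive_mul
    (is_derive_pow (i - j) hpsi) (is_derive_derive1n_psiX j n u0)))).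
move: hd; congr is_derive.
have -> : bell n.+1 i u = - ((i`!)%:R^-1 * \sum_(j < i.+1) (-1) ^+ (n + j) *
    'C(i, j)%:R * (psi rho u ^+ (i - j) *
      derive1n n.+1 (fun v => psi rho v ^+ j) u)).
  rewrite /bell -mulrN; congr (_ * _); rewrite -sumrN.
  by apply: eq_bigr => j _; rewrite addSn exprS; ring.
rewrite opprK.
under eq_bigr do rewrite mulrDr.
rewrite big_split mulrDr /= addrC; congr (_ + _).
case: i => [|i]; first by rewrite big_ord1 subnn !mul0r !mulr0.
(* The top term [j = i.+1] vanishes: there [psi] has exponent 0. *)
rewrite factS natrM big_ord_recr/= subnn !mul0r !mulr0 addr0 /bell !mulr_sumr.
apply: eq_bigr => j _.
have ji : (j <= i)%N by rewrite -ltnS.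
have := congr1 (fun m => m%:R : R) (mul_bin_down i.+1 j).
rewrite /= !natrM => hb.
rewrite subSn// in hb *.
have i1 : (i.+1)%:R != 0 :> R by rewrite pnatr_eq0.
have if0 : (i`!)%:R != 0 :> R by rewrite pnatr_eq0 -lt0n fact_gt0.
have -> : 'C(i, j)%:R = (i - j).+1%:R * 'C(i.+1, j)%:R / i.+1%:R :> R.
  by rewrite -hb mulrC mulKf.
rewrite /=; field.
by rewrite addrC natr1 i1.
Qed.

(** The derivative of [bell], read as a recursion in [n]; any expression [f] valid on [u > 0] may be
    differentiated in place of [bell n i]. *)
Lemma bell_step n i (f : R -> R) (u df : R) : 0 < u ->
  (forall v, 0 < v -> bell n i v = f v) -> is_derive u 1 f df ->
  bell n.+1 i u =
    (if i is i'.+1 then tau rho 1 u * bell n i' u else 0) - df.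
Proof.
move=> u0 bf hf; have := is_derive_pos u0 bf (is_derive_bell n i u0).
by move=> /is_derive_inj/(_ hf) <-; rewrite opprB addrC subrK.
Qed.

(** For [n = 0] the sum is the binomial expansion of [(psi - psi) ^ i]. *)
Lemma bell0 i u : bell 0 i u = (i == 0)%:R.
Proof.
rewrite /bell; transitivity ((i`!)%:R^-1 * (psi rho u - psi rho u) ^+ i).
  congr (_ * _); rewrite exprBn; apply: eq_bigr => j _.
  by rewrite derive1n0 add0n -mulr_natr; ring.
by rewrite subrr expr0n; case: i => [|i]; rewrite ?mulr0// invr1 mulr1.
Qed.

Lemma bell_gt n i u : 0 < u -> (n < i)%N -> bell n i u = 0.
Proof.
elim: n i u => [|n IH] [|i] u u0 //; first by rewrite bell0.
move=> ni; rewrite (@bell_step n i.+1 (fun=> 0) u 0 u0) => //.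
  by rewrite IH// mulr0 subr0.
by move=> v v0; rewrite IH// ltnW.
Qed.

Lemma bellS0 n u : 0 < u -> bell n.+1 0 u = 0.
Proof.
elim: n u => [|n IH] u u0.
  rewrite (@bell_step 0 0 (fun=> 1) u 0 u0) ?subr0//.
  by move=> v _; rewrite bell0.
by rewrite (@bell_step n.+1 0 (fun=> 0) u 0 u0) ?subr0.
Qed.

(** The recursion starts at [tau 1], and minus the derivative of [tau] raises its order by one. This
    coefficient is the weight that survives for a block away from [x0]. *)
Lemma bell1 n u : 0 < u -> bell n.+1 1 u = tau rho n.+1 u.
Proof.
elim: n u => [|n IH] u u0.
  rewrite (@bell_step 0 1 (fun=> 0) u 0 u0) ?subr0//.
    by rewrite bell0 mulr1.
  by move=> v _; rewrite bell0.
have := is_derive_tau n u0.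
move=> /(@bell_step n.+1 1 (tau rho n.+1) u _ u0)-> //.
by rewrite bellS0// mulr0 sub0r opprK.
Qed.

(** The cone of polynomials in the [tau] with nonnegative coefficients. It is stable under minus the
    derivative, because [- tau'] is the next [tau], hence under the recursion for [bell]; this
    yields the sign of [bell]. *)
Inductive tau_poly : (R -> R) -> Prop :=
| tau_poly_cst c : 0 <= c -> tau_poly (fun=> c)
| tau_poly_tau q : tau_poly (tau rho q.+1)
| tau_poly_add f g : tau_poly f -> tau_poly g -> tau_poly (fun u => f u + g u)
| tau_poly_mul f g : tau_poly f -> tau_poly g -> tau_poly (fun u => f u * g u).

Lemma tau_poly_ge0 f u : tau_poly f -> 0 <= f u.
Proof.
elim=> {f} [c c0|q|f g _ f0 _ g0|f g _ f0 _ g0] //; first exact: tau_ge0.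
  exact: addr_ge0.
exact: mulr_ge0.
Qed.

Lemma tau_poly_derive f : tau_poly f ->
  exists2 g, tau_poly g & forall u : R, 0 < u -> is_derive u 1 f (- g u).
Proof.
elim=> {f} [c _|q|f1 f2 _ [g1 sg1 h1] _ [g2 sg2 h2]|
    f1 f2 s1 [g1 sg1 h1] s2 [g2 sg2 h2]].
- exists (fun=> 0) => [|u _]; first exact: tau_poly_cst.
  by rewrite oppr0; exact: is_derive_cst.
- exists (tau rho q.+2) => [|u u0]; first exact: tau_poly_tau.
  exact: is_derive_tau.
- exists (fun u => g1 u + g2 u) => [|u u0]; first exact: tau_poly_add.
  by rewrite opprD; apply: is_derive_add; [exact: h1|exact: h2].
- exists (fun u => f1 u * g2 u + f2 u * g1 u) => [|u u0].
    by apply: tau_poly_add; exact: tau_poly_mul.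
  rewrite opprD -!mulrN.
  by apply: is_derive_mul; [exact: h1|exact: h2].
Qed.

Lemma bell_tau_poly n i :
  exists2 f, tau_poly f & forall u, 0 < u -> bell n i u = f u.
Proof.
elim: n i => [|n IH] i.
  exists (fun=> (i == 0)%:R); first by apply: tau_poly_cst; rewrite ler0n.
  by move=> u _; exact: bell0.
have [f tf bf] := IH i; have [g tg fg] := tau_poly_derive tf.
case: i bf => [|i] bf.
  by exists g => // u u0; rewrite (bell_step u0 bf (fg u u0)) sub0r opprK.
have [h th bh] := IH i.
exists (fun u => tau rho 1 u * h u + g u).
  by apply: tau_poly_add => //; apply: tau_poly_mul => //; exact: tau_poly_tau.
by move=> u u0; rewrite (bell_step u0 bf (fg u u0)) bh// opprK.
Qed.

Lemma bell_ge0 n i u : 0 < u -> 0 <= bell n i u.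
Proof.
by move=> u0; have [f tf ->//] := bell_tau_poly n i; exact: tau_poly_ge0.
Qed.

Lemma measurable_derivable (f df : R -> R) :
  (forall u : R, 0 < u -> is_derive u 1 f (df u)) -> measurable_fun D f.
Proof.
move=> hf; apply: open_continuous_measurable_fun; first exact: interval_open.
move=> u; rewrite inE => /posP u0.
apply: differentiable_continuous; apply/derivable1_diffP.
by apply: ex_derive; exact: hf.
Qed.

Lemma measurable_tau q : measurable_fun D (tau rho q.+1).
Proof.
apply: (@measurable_derivable _ (fun u => - tau rho q.+2 u)) => u u0.
exact: is_derive_tau.
Qed.

Lemma measurable_psi : measurable_fun D (psi rho).
Proof.
by apply: (@measurable_derivable _ (tau rho 1)) => u u0; exact: is_derive_psi.
Qed.

Lemma measurable_bell n i : measurable_fun D (bell n i).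
Proof. exact: measurable_derivable (is_derive_bell n i). Qed.

(* (-1) ^+ n times the n-th derivative of expR (- a psi) is
   bell_gen n a * expR (- a psi). *)
Definition bell_gen n (a u : R) : R := \sum_(i < n.+1) a ^+ i * bell n i u.

Lemma is_derive_bell_gen n a (u : R) : 0 < u ->
  is_derive u 1 (bell_gen n a)
    (a * tau rho 1 u * bell_gen n a u - bell_gen n.+1 a u).
Proof.
move=> u0.
(* The extra index adds [bell n n.+1 = 0] and makes the range match that of [bell_gen n.+1]. *)
apply: (@is_derive_pos (fun v => \sum_(i < n.+2) a ^+ i * bell n i v)) => //.
  by move=> v v0; rewrite big_ord_recr/= bell_gt// mulr0 addr0.
have hd := is_derive_bigsum (fun i : 'I_n.+2 =>
  is_derive_scale (a ^+ i) (is_derive_bell n i u0)).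
move: hd; congr is_derive.
under eq_bigr do rewrite mulrBr.
rewrite sumrB; congr (_ - _).
rewrite big_ord_recl mulr0 add0r /bell_gen mulr_sumr.
by apply: eq_bigr => i _; rewrite /= exprS mulrACA.
Qed.

Lemma bell_gen0 a u : bell_gen 0 a u = 1.
Proof. by rewrite /bell_gen big_ord1 bell0 mulr1. Qed.

(** The derivative of the exponential cancels the first term of [is_derive_bell_gen], so
    differentiating only raises the index and flips the sign. *)
Lemma is_derive_expR_bell_gen n a (u : R) : 0 < u ->
  is_derive u 1 (fun u => expR (- (a * psi rho u)) * bell_gen n a u)
    (- (expR (- (a * psi rho u)) * bell_gen n.+1 a u)).
Proof.
move=> u0; have hpsi := is_derive_psi u0.
have he : is_derive u 1 (fun u => expR (- (a * psi rho u)))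
    (- (a * tau rho 1 u * expR (- (a * psi rho u)))).
  have -> : (fun u => expR (- (a * psi rho u))) =
      expR \o (fun u => - a * psi rho u).
    by apply/funext => v; rewrite /= mulNr.
  apply: is_derive_eq.
  by rewrite /GRing.scale /= !mulNr mulrN mulrC.
have := is_derive_mul he (is_derive_bell_gen n a u0).
by congr is_derive; ring.
Qed.

End levy_density.

(* Multiplying the weight by Z amounts to differentiating the Laplace
   transform; iterating produces all the mixed moments. *)
Lemma laplace_step (R : realType) d (T : measurableType d)
    (mu : {measure set T -> \bar R}) (D : set T) (W Z : T -> R) (F : R -> R) :
  measurable D -> measurable_fun D W -> measurable_fun D Z ->
  (forall t, D t -> 0 <= W t) -> (forall t, D t -> 0 <= Z t) ->
  (forall l : R, 0 < l ->
     (\int[mu]_(t in D) (W t * expR (- (l * Z t)))%:E = (F l)%:E)%E) ->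
  forall l df : R, 0 < l -> is_derive l 1 F (- df) ->
  (\int[mu]_(t in D) (W t * Z t * expR (- (l * Z t)))%:E = df%:E)%E.
Proof.
move=> mD mW mZ W0 Z0 hF l df l0 hdf.
have mexp (x : R) : measurable_fun D (fun t => expR (- (x * Z t))).
  apply: measurableT_comp => //; apply: measurableT_comp => //.
  exact: measurable_funM.
have intW (x : R) : 0 < x ->
    mu.-integrable D (EFin \o (fun t => 0 + W t * expR (- (x * Z t)))).
  move=> x0; apply/integrableP; split.
    apply/measurable_EFinP; under eq_fun do rewrite add0r.
    exact: measurable_funM.
  under eq_integral => t.
    rewrite inE /= => Dt; rewrite add0r ger0_norm; last first.
      by rewrite mulr_ge0 ?W0 ?expR_ge0.
    over.
  by rewrite hF// ltry.
have intd (x : R) : 0 < x ->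
    mu.-integrable D (EFin \o (fun t => W t * Z t * expR (- (x * Z t)))).
  (* Half of the exponent absorbs [Z]: [(x / 2) Z exp (- (x / 2) Z) <= 1], and what remains is
     integrable by [intW] at [x / 2]. *)
  move=> x0; have x20 : 0 < x / 2 by rewrite divr_gt0.
  apply: (@le_integrable _ _ _ mu D mD _
    (fun t => ((x / 2)^-1)%:E * (0 + W t * expR (- (x / 2 * Z t)))%:E)%E).
  - by apply/measurable_EFinP; apply: measurable_funM => //; exact: measurable_funM.
  - move=> t Dt; rewrite /= lee_fin add0r !ger0_norm; last first.
    + by rewrite !mulr_ge0 ?W0 ?Z0 ?expR_ge0.
    + by rewrite !mulr_ge0 ?W0 ?expR_ge0// invr_ge0 ltW.
    rewrite -mulrA [leRHS]mulrCA ler_wpM2l ?W0//.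
    rewrite ler_pdivlMl// {2}(splitr x) mulrDl opprD expRD mulrA.
    rewrite !mulrA -[leRHS]mul1r ler_wpM2r ?expR_ge0// expRN ler_pdivrMr ?expR_gt0// mul1r.
    by rewrite (le_trans _ (expR_ge1Dx _))// lerDr.
  - by apply: integrableZl => //; exact: intW.
have hd := is_derive_Rintegral_expR mD Z0 intW intd l0.
have hd' : is_derive l 1 F (- \int[mu]_(t in D) (W t * Z t * expR (- (l * Z t)))).
  apply: is_derive_pos hd => // v v0.
  rewrite /Rintegral; under eq_integral do rewrite add0r.
  by rewrite hF.
have := is_derive_inj hdf hd' => /oppr_inj ->.
by rewrite fineK//; apply: integrable_fin_num => //; exact: intd.
Qed.

(** * Gamma integrals and negative integer powers *)

Lemma integral_pow_expRN (R : realType) n (r : R) : 0 < r ->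
  (\int[lebesgue_measure]_(u in `]0%R, +oo[) (u ^+ n * expR (- (r * u)))%:E =
   (n`!%:R / r ^+ n.+1)%:E)%E.
Proof.
elim: n r => [|n IH] r r0.
  have := @integral_exponential_pdf R _ r0.
  rewrite /exponential_pdf; under eq_integral do rewrite /patch.
  have -> : (fun x : R => (if x \in `[0, +oo[%classic then r * expR (- r * x) else 0)%:E) =
    (fun x => r%:E * (expR (- (r * x)))%:E)%E \_ `[0, +oo[.
    by apply/funext => x; rewrite patchE; case: ifPn => // _; rewrite mulNr.
  rewrite -integral_mkcond ge0_integralZl//=; last 2 first.
  - apply/measurable_EFinP; apply: measurableT_comp => //.
    by apply: measurableT_comp => //; exact: measurable_funM.
  - by rewrite lee_fin ltW.
  rewrite -integral_itv_obnd_cbnd; last first.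
    apply/measurable_EFinP; apply: measurableT_comp => //.
    by apply: measurableT_comp => //; exact: measurable_funM.
  under [in X in _ -> X]eq_integral do rewrite expr0 mul1r.
  move=> /(congr1 (fun x => (r^-1)%:E * x)%E).
  rewrite muleA -EFinM mulVf ?gt_eqF// mul1e mule1 => ->.
  by rewrite fact0 expr1 mul1r.
under eq_integral do rewrite exprSr.
(* Weight [u ^ n] and [Z = u]: one Laplace derivative in [r] raises the power. The base case was the
   exponential density. *)
apply: (laplace_step (F := fun r => n`!%:R / r ^+ n.+1)) => //.
- by move=> u; rewrite /= in_itv/= andbT => u0; rewrite exprn_ge0// ltW.
- by move=> u; rewrite /= in_itv/= andbT => /ltW.
have rn : r ^+ n.+1 != 0 by rewrite expf_neq0// gt_eqF.
have hX : is_derive r 1 (fun x : R => x ^+ n.+1) (n.+1%:R * r ^+ n * 1).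
  exact: is_derive_pow.
have := is_derive_scale (n`!%:R) 
  (is_deriveV (f := fun x : R => x ^+ n.+1) (x := r) rn hX).
congr is_derive.
rewrite [X in _ * X](_ : _ = - r ^+ n.+1 ^- 2 * (n.+1%:R * r ^+ n * 1))//.
have r0' : r != 0 by rewrite gt_eqF.
rewrite factS natrM !exprS; field.
by rewrite r0' expf_neq0.
Qed.

Lemma GammaE (R : realType) n : Gamma (n.+1%:R : R) = n`!%:R.
Proof.
rewrite /Gamma /Rintegral.
have /(congr1 fine) := @integral_pow_expRN R n 1 ltr01.
rewrite expr1n divr1 => /= <-; congr fine; apply: eq_integral => u.
rewrite inE/= in_itv/= andbT => u0.
by rewrite -natr1 addrK powR_mulrn ?ltW// mul1r.
Qed.

Lemma invX_Gamma (R : realType) n (r : R) : 0 < r -> (0 < n)%N ->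
  ((r ^- n)%:E = (Gamma (n%:R : R))^-1%:E *
    \int[lebesgue_measure]_(u in `]0%R, +oo[) (u ^+ (n - 1) * expR (- (u * r)))%:E)%E.
Proof.
case: n => // n r0 _; rewrite subn1/= GammaE.
under eq_integral do rewrite (mulrC _ r).
rewrite integral_pow_expRN// -EFinM; congr EFin.
by rewrite mulrA mulVf ?mul1r// pnatr_eq0 -lt0n fact_gt0.
Qed.

Section tonelli_restr.
Context d1 d2 (T1 : measurableType d1) (T2 : measurableType d2) (R : realType).
Variables (m1 : {sigma_finite_measure set T1 -> \bar R})
  (m2 : {sigma_finite_measure set T2 -> \bar R}).
Variables (D : set T2) (f : T1 -> T2 -> R).
Hypothesis mD : measurable D.
Hypothesis mf : measurable_fun setT (fun p : T1 * T2 => f p.1 p.2).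
Hypothesis f0 : forall x y, D y -> 0 <= f x y.

(** Nonnegativity is known only for second coordinates in [D], so Tonelli is applied to [f] times
    the indicator of [D]. *)
Let g (p : T1 * T2) := (f p.1 p.2 * \1_D p.2)%:E.

Let mg : measurable_fun setT g.
Proof.
apply/measurable_EFinP; apply: measurable_funM => //.
by apply: measurableT_comp => //; exact: measurable_indic.
Qed.

Let g0 p : (0 <= g p)%E.
Proof.
rewrite /g lee_fin indicE; case: (boolP (p.2 \in D)) => [|_]; last by rewrite mulr0.
by rewrite inE mulr1; exact: f0.
Qed.

Let restrE x : (\int[m2]_(y in D) (f x y)%:E = \int[m2]_y g (x, y))%E.
Proof.
rewrite integral_mkcond; apply: eq_integral => y _.
by rewrite epatch_indic /g /= EFinM.
Qed.

Lemma measurable_integral_restr :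
  measurable_fun setT (fun x => \int[m2]_(y in D) (f x y)%:E)%E.
Proof.
under eq_fun do rewrite restrE.
exact: (measurable_fun_fubini_tonelli_F _ mg g0).
Qed.

Lemma fubini_tonelli_restr :
  (\int[m1]_x \int[m2]_(y in D) (f x y)%:E =
   \int[m2]_(y in D) \int[m1]_x (f x y)%:E)%E.
Proof.
under eq_integral do rewrite restrE.
rewrite (fubini_tonelli _ mg g0) [RHS]integral_mkcond.
apply: eq_integral => y _; rewrite patchE; case: ifPn => yD.
  by apply: eq_integral => x _; rewrite /g /= indicE yD mulr1.
by rewrite integral0_eq// => x _; rewrite /g/= indicE (negPf yD) mulr0.
Qed.

End tonelli_restr.

(** * Moments of normalized independent masses *)

Section moments.
Context {R : realType} (rho : R -> R).
Hypothesis rho_meas : measurable_fun (`]0, +oo[%classic : set R) rho.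
Hypothesis rho_ge0 : forall s, 0 < s -> 0 <= rho s.
Hypothesis rho_fin : (\int[lebesgue_measure]_(s in `]0%R, +oo[)
                  (Num.min 1 s * rho s)%:E < +oo)%E.
Context d (Omega : measurableType d) (P : probability Omega R).
Context (J : finType) (Z : J -> Omega -> R) (a : J -> R).
Hypothesis Z_meas : forall j, measurable_fun [set: Omega] (Z j).
Hypothesis Z_ge0 : forall j w, 0 <= Z j w.
Hypothesis Z_laplace : forall l : J -> R, (forall j, 0 < l j) ->
  (\int[P]_w (expR (- \sum_j l j * Z j w))%:E =
   (expR (- \sum_j a j * psi rho (l j)))%:E)%E.

Lemma measurable_prodX (I : finType) (f : I -> J) (n : I -> nat) :
  measurable_fun [set: Omega] (fun w => \prod_i Z (f i) w ^+ n i).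
Proof. by apply: measurable_prod => i _; exact: measurable_funX. Qed.

Lemma measurable_expR_sum (Q : pred J) (l : J -> R) :
  measurable_fun [set: Omega] (fun w => expR (- \sum_(j | Q j) l j * Z j w)).
Proof.
apply: measurableT_comp => //; apply: measurableT_comp => //.
under eq_fun do rewrite -big_filter.
by apply: measurable_sum => j; exact: measurable_funM.
Qed.

(** Induction on the total exponent: one exponent is lowered, then recovered by differentiating in
    the Laplace variable of its cell. Hence [l] has independent coordinates, although it is later
    taken constant. Injectivity of [f] ensures that moving [l (f m0)] affects one factor of the
    product only. *)
Lemma laplace_moments k (f : 'I_k -> J) (n : 'I_k -> nat) (l : J -> R) :
  injective f -> (forall j, 0 < l j) ->
  (\int[P]_w (\prod_m Z (f m) w ^+ n m * expR (- \sum_j l j * Z j w))%:E =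
   (expR (- \sum_j a j * psi rho (l j)) *
     \prod_m bell_gen rho (n m) (a (f m)) (l (f m)))%:E)%E.
Proof.
move=> f_inj; move En : (\sum_m n m)%N => N.
elim: N n l En => [|N IH] n l En l0.
  have n0 m : n m = 0%N.
    by have /eqP := En; rewrite sum_nat_eq0 => /forallP/(_ m)/eqP.
  rewrite [X in (_ * X)%:E]big1 ?mulr1 => [|m _]; last by rewrite n0 bell_gen0.
  rewrite -Z_laplace//; apply: eq_integral => w _.
  by rewrite big1 ?mul1r// => m _; rewrite n0 expr0.
have [m0 nm0] : exists m0, (0 < n m0)%N.
  apply/existsP; rewrite -[X in is_true X]negbK negb_exists; apply/negP => /forallP h.
  suff : (\sum_m n m)%N = 0%N by rewrite En.
  by apply: big1 => m _; apply/eqP; rewrite -leqn0 leqNgt h.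
pose p := (n m0).-1; pose j0 := f m0.
pose n' m := if m == m0 then p else n m.
have n'm0 : n' m0 = p by rewrite /n' eqxx.
pose l' (r : R) j := if j == j0 then r else l j.
have En' : (\sum_m n' m = N)%N.
  apply/eqP; rewrite -eqSS -En (bigD1 m0)//= [X in _ == X](bigD1 m0)//=.
  rewrite /n' eqxx -addSn prednK//; apply/eqP; congr addn.
  by apply: eq_bigr => m /negPf ->.
(* Everything but the variable of [j0] is frozen: in [W] under the expectation, in [K] in its
   value. *)
pose W w := \prod_m Z (f m) w ^+ n' m * expR (- \sum_(j | j != j0) l j * Z j w).
pose K := expR (- \sum_(j | j != j0) a j * psi rho (l j)) *
  \prod_(m | m != m0) bell_gen rho (n m) (a (f m)) (l (f m)).
have fj0 m : m != m0 -> f m == j0 = false.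
  by apply: contraNF => /eqP/f_inj ->.
have sumE (g : J -> R -> R) r :
    \sum_j g j (l' r j) = g j0 r + \sum_(j | j != j0) g j (l j).
  rewrite (bigD1 j0)//= {1}/l' eqxx; congr (_ + _).
  by apply: eq_bigr => j /negPf jj0; rewrite /l' jj0.
have hF r : 0 < r -> (\int[P]_w (W w * expR (- (r * Z j0 w)))%:E =
    (K * (expR (- (a j0 * psi rho r)) * bell_gen rho p (a j0) r))%:E)%E.
  move=> r0; transitivity (\int[P]_w
      (\prod_m Z (f m) w ^+ n' m * expR (- \sum_j l' r j * Z j w))%:E)%E.
    apply: eq_integral => w _; congr EFin.
    rewrite (sumE (fun j x => x * Z j w)) opprD expRD /W; ring.
  rewrite IH//; last by move=> j; rewrite /l'; case: ifP.
  congr EFin; rewrite (sumE (fun j x => a j * psi rho x)) opprD expRD.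
  rewrite (bigD1 m0)//= {1}/n' eqxx {1}/l' eqxx.
  rewrite (eq_bigr (fun m => bell_gen rho (n m) (a (f m)) (l (f m)))); last first.
    by move=> m mm0; rewrite /n' (negPf mm0) /l' fj0.
  by rewrite /K; ring.
have -> : (expR (- \sum_j a j * psi rho (l j)) *
    \prod_m bell_gen rho (n m) (a (f m)) (l (f m))) =
    K * (expR (- (a j0 * psi rho (l j0))) * bell_gen rho p.+1 (a j0) (l j0)).
  rewrite (bigD1 j0)//= opprD expRD [X in _ * X](bigD1 m0)//= /K /p prednK//.
  by ring.
transitivity (\int[P]_w (W w * Z j0 w * expR (- (l j0 * Z j0 w)))%:E)%E.
  apply: eq_integral => w _; congr EFin.
  rewrite /W [in LHS](bigD1 m0)//= [in RHS](bigD1 m0)//= n'm0.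
  rewrite [in LHS](bigD1 j0)//= opprD expRD.
  rewrite [in RHS](eq_bigr (fun m => Z (f m) w ^+ n m)) => [|m /negPf mm0]; last first.
    by rewrite /n' mm0.
  have -> : n m0 = p.+1 by rewrite prednK.
  by rewrite exprS -/j0; ring.
have mW : measurable_fun [set: Omega] W.
  by apply: measurable_funM; [exact: measurable_prodX|exact: measurable_expR_sum].
have W0 w : setT w -> 0 <= W w.
  move=> _; rewrite mulr_ge0 ?expR_ge0// prodr_ge0// => m _.
  by rewrite exprn_ge0.
have Zj0 w : setT w -> 0 <= Z j0 w by move=> _; exact: Z_ge0.
pose F r := K * (expR (- (a j0 * psi rho r)) * bell_gen rho p (a j0) r).
have hd : is_derive (l j0) 1 F
    (- (K * (expR (- (a j0 * psi rho (l j0))) * bell_gen rho p.+1 (a j0) (l j0)))).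
  rewrite -mulrN; apply: is_derive_scale.
  exact: is_derive_expR_bell_gen.
exact: (laplace_step measurableT mW (Z_meas j0) W0 Zj0 (F := F) hF (l0 j0) hd).
Qed.

Lemma cell_moment k (f : 'I_k -> J) (n : 'I_k -> nat) (N : nat) :
  injective f -> (\sum_m n m = N)%N -> (0 < N)%N ->
  {ae P, forall w, 0 < \sum_j Z j w} ->
  (\int[P]_w (\prod_m (Z (f m) w / \sum_j Z j w) ^+ n m)%:E =
   (Gamma (N%:R : R))^-1%:E * \int[lebesgue_measure]_(u in `]0%R, +oo[)
     (u ^+ (N - 1) * expR (- ((\sum_j a j) * psi rho u)) *
       \prod_m bell_gen rho (n m) (a (f m)) u)%:E)%E.
Proof.
move=> f_inj nN N0 Tpos.
pose T w := \sum_j Z j w.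
have mT : measurable_fun [set: Omega] T by exact: measurable_sum.
have T0 w : 0 <= T w by exact: sumr_ge0.
pose V w := \prod_m Z (f m) w ^+ n m.
have mV : measurable_fun [set: Omega] V by exact: measurable_prodX.
have V0 w : 0 <= V w by apply: prodr_ge0 => m _; rewrite exprn_ge0.
have pE w : \prod_m (Z (f m) w / T w) ^+ n m = V w * (T w)^-1 ^+ N.
  under eq_bigr do rewrite exprMn.
  by rewrite big_split/= -nN -expr_sum.
have G0 : 0 < (Gamma (N%:R : R))^-1.
  by rewrite -(prednK N0) GammaE invr_gt0 ltr0n fact_gt0.
pose h w u := V w * (u ^+ (N - 1) * expR (- (u * T w))).
have h0 w u : (`]0, +oo[%classic : set R) u -> 0 <= h w u.
  by move=> /posP u0; rewrite !mulr_ge0 ?expR_ge0// exprn_ge0// ltW.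
have mh : measurable_fun setT (fun p : Omega * R => h p.1 p.2).
  apply: measurable_funM; first exact: measurableT_comp.
  apply: measurable_funM; first exact: measurable_funX.
  apply: measurableT_comp => //; apply: measurableT_comp => //.
  by apply: measurable_funM => //; exact: measurableT_comp.
have mh1 w : measurable_fun (`]0, +oo[%classic : set R) (h w).
  apply: measurable_funM => //; apply: measurable_funM.
    exact: measurable_funX.
  apply: measurableT_comp => //; apply: measurableT_comp => //.
  exact: measurable_funM.
have mhI : measurable_fun [set: Omega]
    (fun w => \int[lebesgue_measure]_(u in `]0%R, +oo[) (h w u)%:E)%E.
  exact: (measurable_integral_restr (@lebesgue_measure R) measurable_pos mh h0).
(* The Gamma integral represents [T ^ -N] only where [T w > 0], so the integrands agree almost
   everywhere, not pointwise. *)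
transitivity (\int[P]_w ((Gamma (N%:R : R))^-1%:E *
    \int[lebesgue_measure]_(u in `]0%R, +oo[) (h w u)%:E))%E.
  apply: ge0_ae_eq_integral => //.
  - apply/measurable_EFinP; under eq_fun do rewrite pE.
    apply: measurable_funM => //; apply: measurable_funX.
    have -> : (fun w => (T w)^-1) = (@powR R ^~ (-1)) \o T.
      by apply/funext => w; rewrite /= powR_inv1.
    by apply: measurableT_comp => //; exact: measurable_powR.
  - exact: measurable_funeM.
  - by move=> w _; rewrite pE lee_fin mulr_ge0// exprn_ge0// invr_ge0.
  - move=> w _; rewrite mule_ge0//; first by rewrite lee_fin ltW.
    by apply: integral_ge0 => u Du; rewrite lee_fin h0.
  - apply: filterS Tpos => w Tw _; rewrite pE EFinM exprVn (invX_Gamma Tw N0).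
    rewrite muleCA; congr (_ * _)%E.
    rewrite -ge0_integralZl_EFin//.
    + by move=> u /posP u0; rewrite lee_fin !mulr_ge0 ?expR_ge0// exprn_ge0// ltW.
    + apply/measurable_EFinP; apply: measurable_funM.
        exact: measurable_funX.
      apply: measurableT_comp => //; apply: measurableT_comp => //.
      exact: measurable_funM.
rewrite ge0_integralZl//; last 2 first.
  by move=> w _; apply: integral_ge0 => u Du; rewrite lee_fin h0.
  by rewrite lee_fin ltW.
congr (_ * _)%E.
rewrite (fubini_tonelli_restr P (@lebesgue_measure R) measurable_pos mh h0).
apply: eq_integral => u; rewrite inE => /posP u0.
transitivity (\int[P]_w ((u ^+ (N - 1))%:E *
    (V w * expR (- \sum_j u * Z j w))%:E))%E.
  by apply: eq_integral => w _; rewrite -EFinM /h /T mulr_sumr mulrCA.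
rewrite ge0_integralZl_EFin//.
- rewrite (laplace_moments n f_inj (fun=> u0)).
  by rewrite -EFinM mulr_suml mulrA.
- by move=> w _; rewrite lee_fin mulr_ge0 ?expR_ge0.
- apply/measurable_EFinP; apply: measurable_funM => //.
  exact: (measurable_expR_sum xpredT (fun=> u)).
- by rewrite exprn_ge0// ltW.
Qed.

End moments.

(** * Finite measurable decompositions and positivity of the total mass *)

Section finite_cells.
Context {R : realType} d (T : measurableType d) (J : finType) (cell : T -> J).
Hypothesis cell_meas : forall j, measurable (cell @^-1` [set j]).

Lemma measurable_fun_cell (h : J -> R) : measurable_fun [set: T] (fun x => h (cell x)).
Proof.
move=> _ B mB; rewrite setTI.
have -> : (fun x => h (cell x)) @^-1` B =
    \bigcup_(j in [set j | B (h j)]) (cell @^-1` [set j]).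
  apply/seteqP; split => x /=; first by move=> hB; exists (cell x).
  by case=> j hB /= xj; rewrite xj.
by apply: fin_bigcup_measurable => //; exact: finite_finset.
Qed.

Lemma integral_cell (m : {measure set T -> \bar R}) (h : J -> R) :
  (forall j, 0 <= h j) ->
  (\int[m]_x (h (cell x))%:E = \sum_j (h j)%:E * m (cell @^-1` [set j]))%E.
Proof.
move=> h0.
transitivity (\int[m]_x (\sum_j (h j)%:E * (\1_(cell @^-1` [set j]) x)%:E))%E.
  apply: eq_integral => x _; rewrite (bigD1 (cell x))//= big1 => [|j jx].
    by rewrite adde0 indicE mem_set// mule1.
  by rewrite indicE memNset ?mule0// => /= xj; rewrite xj eqxx in jx.
rewrite ge0_integral_sum//.
- apply: eq_bigr => j _; rewrite ge0_integralZl_EFin//.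
    by rewrite integral_indic// setIT.
  by apply/measurable_EFinP.
- by move=> j; apply/measurable_EFinP/measurable_funM.
- by move=> j x _; rewrite mule_ge0// lee_fin// indicE.
Qed.

Lemma measure_cell_sum (m : {measure set T -> \bar R}) :
  (m [set: T] = \sum_j m (cell @^-1` [set j]))%E.
Proof.
have := @integral_cell m (fun=> 1) (fun=> ler01).
rewrite integral_cst// mul1e => ->.
by apply: eq_bigr => j _; rewrite mul1e.
Qed.

End finite_cells.

Lemma measurable_expeR (R : realType) : measurable_fun [set: \bar R] (@expeR R).
Proof.
apply: (measurability _ (ErealGenOInfty.measurableE R)) => _ /= -[_ [r ->] <-].
rewrite setTI preimage_itvoy.
have [r0|r0|->] := ltgtP r 0.
- rewrite (_ : [set _ | _] = setT)//; apply/seteqP; split => // x _ /=.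
  by rewrite (lt_le_trans _ (expeR_ge0 x))// lte_fin.
- rewrite (_ : [set _ | _] = [set x | (ln r)%:E < x]%E).
    have := @emeasurable_itv R `](ln r)%:E, +oo[.
    by congr measurable; apply/funext => x /=; rewrite in_itv/= andbT.
  apply/funext => x /=; congr is_true.
  by rewrite -(lte_expeR (ln r)%:E) /= lnK.
- rewrite (_ : [set _ | _] = ~` [set -oo%E]); first exact: measurableC.
  apply/seteqP; split => x /=.
    by move=> + xoo; rewrite xoo/= ltxx.
  by move=> /eqP xoo; rewrite expeR_gt0// ltNye.
Qed.

(** By monotone convergence, [psi n.+1] increases to the integral of [rho], which is infinite. *)
Lemma psi_unbounded (R : realType) (rho : R -> R)
    (rho_meas : measurable_fun (`]0, +oo[%classic : set R) rho)
    (rho_ge0 : forall s, 0 < s -> 0 <= rho s)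
    (rho_fin : (\int[lebesgue_measure]_(s in `]0%R, +oo[)
                  (Num.min 1 s * rho s)%:E < +oo)%E)
    (rho_inf : (\int[lebesgue_measure]_(s in `]0%R, +oo[) (rho s)%:E = +oo)%E)
    (M : R) : exists2 u, 0 < u & M < psi rho u.
Proof.
apply: contrapT => h.
have psiM n : psi rho n.+1%:R <= M.
  by rewrite leNgt; apply/negP => hn; apply: h; exists n.+1%:R.
pose g n s := ((1 - expR (- (n.+1%:R * s))) * rho s)%:E.
have D0 s : (`]0, +oo[%classic : set R) s -> 0 < s by exact: posP.
have e1 n s : 0 < s -> 0 <= 1 - expR (- (n.+1%:R * s)) :> R.
  by move=> s0; rewrite subr_ge0 expR_le1 oppr_le0 mulr_ge0// ltW.
have gpsi n : (\int[lebesgue_measure]_(s in `]0%R, +oo[) g n s = (psi rho n.+1%:R)%:E)%E.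
  rewrite /psi fineK//; apply: integrable_fin_num => //.
  exact: (integrable_psi rho_meas rho_ge0 rho_fin (ler0n _ n.+1)).
have mg n : measurable_fun (`]0, +oo[%classic : set R) (g n).
  apply/measurable_EFinP; apply: measurable_funM => //.
  by apply: measurable_funB => //; exact: measurable_expRN.
have g0 n s : (`]0, +oo[%classic : set R) s -> (0 <= g n s)%E.
  by move=> /D0 s0; rewrite lee_fin mulr_ge0 ?rho_ge0 ?e1.
have ndg s : (`]0, +oo[%classic : set R) s ->
    {homo g^~ s : n m / (n <= m)%N >-> (n <= m)%E}.
  move=> /D0 s0 p q pq; rewrite lee_fin ler_wpM2r ?rho_ge0//.
  by rewrite lerB// ler_expR lerN2 (ler_wpM2r (ltW s0))// ler_nat.
have := cvg_monotone_convergence (mu := lebesgue_measure) measurable_pos mg g0 ndg.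
have -> : (\int[lebesgue_measure]_(s in `]0%R, +oo[) (fun s => limn (g^~ s)) s = +oo)%E.
  rewrite -[RHS]rho_inf; apply: eq_integral => s; rewrite inE => /D0 s0.
  apply/cvg_lim => //; rewrite /g.
  apply: cvg_EFin; first by apply: nearW.
  rewrite (_ : _ \o _ = fun n => (1 - expR (- (n.+1%:R * s))) * rho s)//.
  suff : (1 - expR (- (n.+1%:R * s))) * rho s @[n --> \oo] --> (1 - 0) * rho s.
    by rewrite subr0 mul1r.
  apply: cvgMl; apply: cvgB; first exact: cvg_cst.
  apply: (cvg_comp (fun n => n.+1%:R * s) (fun x => expR (- x))); last first.
    exact: cvgr_expR.
  apply/cvgryPge => A; near=> n.
  rewrite -ler_pdivrMr// (@le_trans _ _ n%:R) ?ler_nat//.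
  by near: n; exact: nbhs_infty_ger.
under eq_fun do rewrite gpsi.
move=> /cvgeyPge/(_ (M + 1)) [n _ /(_ n (leqnn n))] /=.
by rewrite lee_fin => /le_trans/(_ (psiM n)); rewrite gerDl ler10.
Unshelve. all: by end_near. Qed.

Lemma emeasurable_prod (R : realType) d (T : measurableType d) (D : set T)
    (I : Type) (s : seq I) (h : I -> T -> \bar R) :
  (forall i, measurable_fun D (h i)) ->
  measurable_fun D (fun x => \prod_(i <- s) h i x)%E.
Proof.
move=> mh; elim: s => [|i s IH].
  by under eq_fun do rewrite big_nil; exact: measurable_cst.
under eq_fun do rewrite big_cons.
exact: emeasurable_funM.
Qed.

Lemma measurable_prod_eval (R : realType) d (T : measurableType d)
    (I : Type) (s : seq I) (A : I -> set T) :
  (forall i, measurable (A i)) ->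
  measurable_fun setT (fun p : pprobability T R => \prod_(i <- s) p (A i))%E.
Proof.
move=> mA; apply: emeasurable_prod => i.
exact: (measurable_kernel (kprobability (@measurable_id _ (pprobability T R) setT))).
Qed.

(** With [T] the total, [P (T = 0) <= E exp (- u T) = exp (- (sum a) psi u)] for every [u > 0], and
    the right side is arbitrarily small since [psi] is unbounded. *)
Lemma total_mass_gt0 (R : realType) (rho : R -> R)
    (rho_meas : measurable_fun (`]0, +oo[%classic : set R) rho)
    (rho_ge0 : forall s, 0 < s -> 0 <= rho s)
    (rho_fin : (\int[lebesgue_measure]_(s in `]0%R, +oo[)
                  (Num.min 1 s * rho s)%:E < +oo)%E)
    (rho_inf : (\int[lebesgue_measure]_(s in `]0%R, +oo[) (rho s)%:E = +oo)%E)
    d (Omega : measurableType d) (P : probability Omega R)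
    (J : finType) (Z : J -> Omega -> R) (a : J -> R) :
  (forall j, measurable_fun [set: Omega] (Z j)) -> (forall j w, 0 <= Z j w) ->
  (forall l : J -> R, (forall j, 0 < l j) ->
    (\int[P]_w (expR (- \sum_j l j * Z j w))%:E =
     (expR (- \sum_j a j * psi rho (l j)))%:E)%E) ->
  0 < \sum_j a j -> {ae P, forall w, 0 < \sum_j Z j w}.
Proof.
move=> mZ Z0 hZ a0.
have mT : measurable_fun [set: Omega] (fun w => \sum_j Z j w) by exact: measurable_sum.
pose A := [set w | \sum_j Z j w = 0].
have mA : measurable A.
  by have := mT measurableT [set 0] (measurable_set1 0); rewrite setTI.
have PA_le u : 0 < u -> (P A <= (expR (- ((\sum_j a j) * psi rho u)))%:E)%E.
  move=> u0; rewrite mulr_suml -(hZ (fun=> u) (fun=> u0)).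
  rewrite -(setIT A) -integral_indic//; apply: ge0_le_integral => //.
  - exact/measurable_EFinP/measurable_indic.
  - apply/measurable_EFinP; apply: measurableT_comp => //; apply: measurableT_comp => //.
    by apply: measurable_sum => j; exact: measurable_funM.
  - move=> w _; rewrite lee_fin indicE -mulr_sumr.
    have [|_] := boolP (w \in A); last by rewrite expR_ge0.
    by rewrite inE => ->; rewrite mulr0 oppr0 expR0.
exists A; split => //; last first.
  move=> w /= /negP; rewrite -leNgt => T0; apply/eqP; rewrite eq_le T0/=.
  exact: sumr_ge0.
apply: contrapT => /eqP PA; have : (0 < P A)%E by rewrite lt0e PA measure_ge0.
have PAfin := fin_num_measure P A mA.
rewrite -(fineK PAfin) lte_fin; set r := fine _ => r0.
(* With [r = P A > 0], the threshold is chosen to make the bound at [u] smaller than [r] itself. *)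
have [u u0 hu] := psi_unbounded rho_meas rho_ge0 rho_fin rho_inf (- ln r / \sum_j a j).
have := PA_le u u0; rewrite -(fineK PAfin) lee_fin -/r leNgt => /negP; apply.
by rewrite -[ltRHS](lnK r0) ltr_expR ltrNl mulrC -ltr_pdivrMr.
Qed.

(** * Cells of a completely random measure *)

Section crm_cells.
Context {R : realType} (rho : R -> R).
Hypothesis rho_meas : measurable_fun (`]0, +oo[%classic : set R) rho.
Hypothesis rho_ge0 : forall s, 0 < s -> 0 <= rho s.
Hypothesis rho_fin : (\int[lebesgue_measure]_(s in `]0%R, +oo[)
                  (Num.min 1 s * rho s)%:E < +oo)%E.
Context (X : ptopologicalType) (c : R) (H : probability (borel X) R).
Context d (Omega : measurableType d) (P : probability Omega R)
  (mu : R.-ker Omega ~> borel X).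
Hypothesis crm : homogeneous_CRM P mu rho c H.
Context (J : finType) (cell : borel X -> J).
Hypothesis cell_meas : forall j, measurable (cell @^-1` [set j]).

(** [fine] sends an infinite mass to 0, so the value is the true mass as soon as the total is
    finite, that is almost surely. *)
Definition cell_mass j w : R := fine (mu w (cell @^-1` [set j])).

Lemma measurable_cell_mass j : measurable_fun [set: Omega] (cell_mass j).
Proof.
apply: measurableT_comp; first exact: fine_measurable.
exact: measurable_kernel.
Qed.

Lemma cell_mass_ge0 j w : 0 <= cell_mass j w.
Proof. exact: fine_ge0. Qed.

Lemma cell_massE w j : (mu w [set: borel X] < +oo)%E ->
  mu w (cell @^-1` [set j]) = (cell_mass j w)%:E.
Proof.
move=> muT; rewrite fineK// ge0_fin_numE//.
by apply: le_lt_trans muT; apply: le_measure; rewrite ?inE.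
Qed.

Lemma cell_mass_sum w : (mu w [set: borel X] < +oo)%E ->
  mu w [set: borel X] = (\sum_j cell_mass j w)%:E.
Proof.
move=> muT; rewrite (measure_cell_sum cell_meas) -sumEFin.
by apply: eq_bigr => j _; rewrite cell_massE.
Qed.

(** The Laplace functional is taken at the step function [l \o cell], for which the Levy integral
    reduces to a finite sum of values of [psi]. *)
Lemma cell_mass_laplace (l : J -> R) : (forall j, 0 < l j) ->
  (\int[P]_w (expR (- \sum_j l j * cell_mass j w))%:E =
   (expR (- \sum_j (c * fine (H (cell @^-1` [set j]))) * psi rho (l j)))%:E)%E.
Proof.
move=> l0; have [_ fin lev] := crm.
have l0' j : 0 <= l j by exact: ltW.
have := lev (fun x => l (cell x)) (measurable_fun_cell cell_meas l) (fun x => l0' _).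
have intmu w : (\int[mu w]_x (l (cell x))%:E =
    \sum_j (l j)%:E * mu w (cell @^-1` [set j]))%E by exact: integral_cell.
under eq_integral do rewrite intmu.
have intH : (\int[H]_x \int[lebesgue_measure]_(s in `]0%R, +oo[)
    ((1 - expR (- (s * l (cell x)))) * rho s)%:E =
    (\sum_j psi rho (l j) * fine (H (cell @^-1` [set j])))%:E)%E.
  transitivity (\int[H]_x (psi rho (l (cell x)))%:E)%E.
    apply: eq_integral => x _; rewrite /psi fineK.
      by apply: eq_integral => s _; rewrite (mulrC s).
    apply: integrable_fin_num => //.
    exact: (integrable_psi rho_meas rho_ge0 rho_fin).
  rewrite (integral_cell cell_meas H (fun j => psi_ge0 rho_ge0 (l0' j))) -sumEFin.
  by apply: eq_bigr => j _; rewrite EFinM; congr (_ * _)%E;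
    rewrite fineK//; exact: fin_num_measure.
rewrite intH -EFinM -EFinN /= => hlev.
transitivity (expR (- (c * \sum_j psi rho (l j) *
    fine (H (cell @^-1` [set j])))))%:E; last first.
  by rewrite mulr_sumr; congr (expR (- _))%:E; apply: eq_bigr => j _; ring.
rewrite -hlev.
apply: ge0_ae_eq_integral => //.
- apply/measurable_EFinP; apply: measurableT_comp => //; apply: measurableT_comp => //.
  apply: measurable_sum => j; apply: measurable_funM => //.
  exact: measurable_cell_mass.
- apply: measurableT_comp; first exact: measurable_expeR.
  apply: measurableT_comp => //; apply: emeasurable_sum => j.
  apply: measurable_funeM; exact: measurable_kernel.
- by move=> w _; rewrite expeR_ge0.
- apply: filterS fin => w muT _.
  rewrite -(_ : (- \sum_j l j * cell_mass j w)%:E =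
    - \sum_j (l j)%:E * mu w (cell @^-1` [set j]))%E//.
  rewrite EFinN -sumEFin; congr (- _)%E; apply: eq_bigr => j _.
  by rewrite EFinM cell_massE.
Qed.

Lemma cell_weight_sum : \sum_j c * fine (H (cell @^-1` [set j])) = c.
Proof.
rewrite -mulr_sumr; suff -> : \sum_j fine (H (cell @^-1` [set j])) = 1.
  by rewrite mulr1.
apply: EFin_inj; rewrite -sumEFin -(probability_setT H) (measure_cell_sum cell_meas).
by apply: eq_bigr => j _; rewrite fineK// fin_num_measure.
Qed.

Hypothesis rho_inf : (\int[lebesgue_measure]_(s in `]0%R, +oo[) (rho s)%:E = +oo)%E.
Hypothesis c_gt0 : 0 < c.

Lemma total_cell_mass_gt0 : {ae P, forall w, 0 < \sum_j cell_mass j w}.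
Proof.
apply: (total_mass_gt0 rho_meas rho_ge0 rho_fin rho_inf
  measurable_cell_mass cell_mass_ge0 cell_mass_laplace).
by rewrite cell_weight_sum.
Qed.

Lemma mnormalize_cell : {ae P, forall w, forall j,
  mnormalize (mu w) point (cell @^-1` [set j]) =
  (cell_mass j w / \sum_j cell_mass j w)%:E}.
Proof.
have [_ fin _] := crm.
apply: filterS2 fin total_cell_mass_gt0 => w muT Tw j.
rewrite /mnormalize cell_mass_sum// eqe gt_eqF//=.
by rewrite cell_massE.
Qed.

(** The product over observations gathers, block by block, into powers of the normalized masses, to
    which [cell_moment] applies. *)
Lemma mnormalize_cell_moment k (f : 'I_k -> J) (n : nat) (b : 'I_n -> 'I_k) :
  injective f -> (0 < n)%N ->
  (\int[P]_w \prod_a mnormalize (mu w) point (cell @^-1` [set f (b a)]) =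
   (Gamma (n%:R : R))^-1%:E * \int[lebesgue_measure]_(u in `]0%R, +oo[)
     (u ^+ (n - 1) * expR (- (c * psi rho u)) *
       \prod_m bell_gen rho #|[pred a | b a == m]|
                 (c * fine (H (cell @^-1` [set f m]))) u)%:E)%E.
Proof.
move=> f_inj n0.
have sumn : (\sum_m #|[pred a | b a == m]| = n)%N.
  rewrite -[RHS]card_ord -sum1_card (partition_big b xpredT)//=.
  by apply: eq_bigr => m _; rewrite -sum1_card.
have := cell_moment rho_meas rho_ge0 rho_fin measurable_cell_mass cell_mass_ge0
  cell_mass_laplace f_inj sumn n0 total_cell_mass_gt0.
rewrite /= cell_weight_sum => <-.
apply: ge0_ae_eq_integral => //.
- have mn : measurable_fun [set: Omega]
      (fun w => mnormalize (mu w) point : pprobability (borel X) R).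
    exact: measurable_fun_mnormalize.
  have me := @measurable_prod_eval R _ (borel X) _ (index_enum 'I_n)
    (fun a => cell @^-1` [set f (b a)]) (fun a => cell_meas _).
  exact: (measurableT_comp me mn).
- apply/measurable_EFinP; apply: measurable_prod => m _; apply: measurable_funX.
  apply: measurable_funM; first exact: measurable_cell_mass.
  have -> : (fun w => (\sum_j cell_mass j w)^-1) =
      (@powR R ^~ (-1)) \o (fun w => \sum_j cell_mass j w).
    apply/funext => w; rewrite /= powR_inv1//.
    by apply: sumr_ge0 => j _; exact: cell_mass_ge0.
  apply: measurableT_comp; first exact: measurable_powR.
  by apply: measurable_sum => j; exact: measurable_cell_mass.
- by move=> w _; apply: prode_ge0 => a _.
- move=> w _; rewrite lee_fin prodr_ge0// => m _; rewrite exprn_ge0// divr_ge0 ?cell_mass_ge0//.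
  by rewrite sumr_ge0// => j _; exact: cell_mass_ge0.
apply: filterS mnormalize_cell => w hw _.
transitivity ((\prod_a (cell_mass (f (b a)) w / \sum_j cell_mass j w))%:E)%E.
  by rewrite -prodEFin; apply: eq_bigr => a _; exact: hw.
congr EFin; rewrite (partition_big b xpredT)//=; apply: eq_bigr => m _.
under eq_bigr => a /eqP -> do over.
by rewrite prodr_const.
Qed.

End crm_cells.

(** * Law of the cell ties of the sample *)

Lemma integral_mnormalize (R : realType) (X : ptopologicalType)
    (L : probability (pprobability (borel X) R) R)
    d (Omega : measurableType d) (P : probability Omega R)
    (mu : R.-ker Omega ~> borel X) (F : pprobability (borel X) R -> \bar R) :
  (forall B : set (pprobability (borel X) R), measurable B ->
      L B = P ((fun w => mnormalize (mu w) point : pprobability (borel X) R)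
                 @^-1` B)) ->
  measurable_fun setT F -> (forall p, (0 <= F p)%E) ->
  (\int[L]_p F p =
   \int[P]_w F (mnormalize (mu w) point : pprobability (borel X) R))%E.
Proof.
move=> hL mF F0.
have mn : measurable_fun [set: Omega]
    (fun w => mnormalize (mu w) point : pprobability (borel X) R).
  exact: measurable_fun_mnormalize.
rewrite (eq_measure_integral (pushforward P
  (fun w => mnormalize (mu w) point : pprobability (borel X) R))); last first.
  by move=> A mA _; exact: hL.
by rewrite ge0_integral_pushforward.
Qed.

Lemma conditionally_iid_cells (R : realType) (X : ptopologicalType) (rho : R -> R)
    (rho_meas : measurable_fun (`]0, +oo[%classic : set R) rho)
    (rho_ge0 : forall s, 0 < s -> 0 <= rho s)
    (rho_fin : (\int[lebesgue_measure]_(s in `]0%R, +oo[)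
                  (Num.min 1 s * rho s)%:E < +oo)%E)
    (rho_inf : (\int[lebesgue_measure]_(s in `]0%R, +oo[) (rho s)%:E = +oo)%E)
    (c : R) (c_gt0 : 0 < c) (H : probability (borel X) R)
    (d : measure_display) (Omega : measurableType d) (P : probability Omega R)
    (Pt : {RV P >-> pprobability (borel X) R})
    (Pt_law : hNRMI rho c H (distribution P Pt))
    (n : nat) (n_gt0 : (0 < n)%N) (Y : 'I_n -> {RV P >-> borel X})
    (Y_iid : conditionally_iid P Pt (fun a => Y a : Omega -> borel X))
    (J : finType) (cell : borel X -> J)
    (cell_meas : forall j, measurable (cell @^-1` [set j]))
    (k : nat) (f : 'I_k -> J) (b : 'I_n -> 'I_k) : injective f ->
  (P [set w | forall a, cell (Y a w) = f (b a)] =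
   (Gamma (n%:R : R))^-1%:E * \int[lebesgue_measure]_(u in `]0%R, +oo[)
     (u ^+ (n - 1) * expR (- (c * psi rho u)) *
       \prod_m bell_gen rho #|[pred a | b a == m]|
                 (c * fine (H (cell @^-1` [set f m]))) u)%:E)%E.
Proof.
move=> f_inj; case: Pt_law => d1 [W1 [P1 [nu]]] [crm hL].
rewrite -(mnormalize_cell_moment rho_meas rho_ge0 rho_fin crm cell_meas rho_inf
  c_gt0 b f_inj n_gt0).
pose A a := cell @^-1` [set f (b a)].
have mA a : measurable (A a) by exact: cell_meas.
have -> : [set w | forall a, cell (Y a w) = f (b a)] =
    \bigcap_(a in [set: 'I_n]) (Y a @^-1` A a).
  by apply/seteqP; split => w h a; [move=> _; exact: h|exact: (h a I)].
have [_ hF] := Y_iid A mA.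
(* The conditional probability is integrated over the sure event, which belongs to the sigma-algebra
   of [Pt]; the probability becomes a moment of [Pt]. *)
have GT : preimage_set_system [set: Omega] Pt measurable [set: Omega].
  by exists setT => //; rewrite setTI preimage_setT.
have := hF _ GT; rewrite setIT => ->.
have mF := @measurable_prod_eval R _ (borel X) _ (index_enum 'I_n) A mA.
have F0 (p : pprobability (borel X) R) : (0 <= \prod_(a < n) p (A a))%E.
  by apply: prode_ge0 => a _; exact: measure_ge0.
rewrite -(integral_mnormalize hL mF F0).
by rewrite ge0_integral_distribution.
Qed.

(** Lifts a permutation of the block sizes to one of the blocks, so that the blocks of [pi] can be
    listed with the [m]-th of size [ns m]. *)
Lemma perm_map_lift (T1 T2 : eqType) (f : T1 -> T2) (s : seq T2) (t : seq T1) :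
  perm_eq s (map f t) -> exists2 u, s = map f u & perm_eq u t.
Proof.
case: t => [|x t]; first by move=> /perm_nilP ->; exists [::].
move=> /(perm_iotaP (f x)) [Is pIs ->].
exists (map (nth x (x :: t)) Is).
  rewrite -map_comp; apply/eq_in_map => i; rewrite (perm_mem pIs) mem_iota size_map => it /=.
  by rewrite -(nth_map x (f x) f).
rewrite size_map in pIs; apply: (perm_trans (perm_map _ pIs)).
by rewrite map_nth_iota0// take_size.
Qed.

(** [b a] is the rank of the block of [a] in such a listing. Equality with [pi] becomes a condition
    on pairs of indices, which makes sense for points and for cells alike. *)
Lemma partition_labelling (n k : nat) (ns : 'I_k -> nat) (pi : {set {set 'I_n}}) :
  finset.partition pi [set: 'I_n]%SET ->
  perm_eq [seq #|B : {set 'I_n}| | B in pi] [seq ns m | m : 'I_k] ->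
  exists b : 'I_n -> 'I_k, (forall m, #|[pred a | b a == m]| = ns m) /\
    forall (T : eqType) (y : 'I_n -> T), tie_partition y = pi <->
      forall a a', (y a == y a') = (b a == b a').
Proof.
move=> pi_part; rewrite perm_sym => /perm_map_lift [u hu upi].
have su : size u = k by have := congr1 size hu; rewrite size_map size_image card_ord.
have uu : uniq u by rewrite (perm_uniq upi) enum_uniq.
have memu B : (B \in u) = (B \in pi) by rewrite (perm_mem upi) mem_enum.
have /and3P [/eqP covpi trivpi _] := pi_part.
have pblu a : finset.pblock pi a \in u by rewrite memu finset.pblock_mem// covpi inE.
have idx a : (index (finset.pblock pi a) u < k)%N by rewrite -su index_mem.
pose b a := Ordinal (idx a).
have bE a m : (b a == m) = (a \in nth finset.set0 u m).
  have mu : (m < size u)%N by rewrite su.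
  have um : nth finset.set0 u m \in pi by rewrite -memu mem_nth.
  apply/eqP/idP => [<-|am].
    by rewrite /= nth_index// finset.mem_pblock covpi inE.
  by apply: val_inj; rewrite /= (finset.def_pblock trivpi um am) index_uniq.
have bb a a' : (b a == b a') = (a' \in finset.pblock pi a).
  by rewrite eq_sym bE /= nth_index.
exists b; split.
  move=> m; rewrite (_ : ns m = #|nth finset.set0 u m|); last first.
    have := congr1 (fun s => nth 0%N s m) hu.
    rewrite /image_mem (nth_map m) ?size_enum_ord// nth_ord_enum => ->.
    by rewrite (nth_map finset.set0) ?su.
  by apply: eq_card => a; rewrite inE bE.
move=> T y; split => [h a a'|h].
  rewrite bb -h finset.pblock_equivalence_partition ?inE//.
  by split => // /eqP ->.
rewrite -[RHS](finset.equivalence_partition_pblock pi_part) /tie_partition.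
by congr equivalence_partition; apply/funext => a; apply/funext => a'; rewrite h bb.
Qed.

(** The event splits over the vectors of cells visited by the sample. A vector with the ties of [b]
    is [f \o b] for exactly one injective [f], recovered through the section [s] of [b]. *)
Lemma tie_partition_cells (R : realType) (X : ptopologicalType) (rho : R -> R)
    (rho_meas : measurable_fun (`]0, +oo[%classic : set R) rho)
    (rho_ge0 : forall s, 0 < s -> 0 <= rho s)
    (rho_fin : (\int[lebesgue_measure]_(s in `]0%R, +oo[)
                  (Num.min 1 s * rho s)%:E < +oo)%E)
    (rho_inf : (\int[lebesgue_measure]_(s in `]0%R, +oo[) (rho s)%:E = +oo)%E)
    (c : R) (c_gt0 : 0 < c) (H : probability (borel X) R)
    (d : measure_display) (Omega : measurableType d) (P : probability Omega R)
    (Pt : {RV P >-> pprobability (borel X) R})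
    (Pt_law : hNRMI rho c H (distribution P Pt))
    (n : nat) (n_gt0 : (0 < n)%N) (Y : 'I_n -> {RV P >-> borel X})
    (Y_iid : conditionally_iid P Pt (fun a => Y a : Omega -> borel X))
    (J : finType) (cell : borel X -> J)
    (cell_meas : forall j, measurable (cell @^-1` [set j]))
    (k : nat) (b : 'I_n -> 'I_k) : (forall m, exists a, b a = m) ->
  (P [set w | forall a a', (cell (Y a w) == cell (Y a' w)) = (b a == b a')] =
   \sum_(f : {ffun 'I_k -> J} | injectiveb f)
     (Gamma (n%:R : R))^-1%:E * \int[lebesgue_measure]_(u in `]0%R, +oo[)
     (u ^+ (n - 1) * expR (- (c * psi rho u)) *
       \prod_m bell_gen rho #|[pred a | b a == m]|
                 (c * fine (H (cell @^-1` [set f m]))) u)%:E)%E.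
Proof.
move=> /choice [s bs].
pose good (f : {ffun 'I_n -> J}) := [forall a, forall a', (f a == f a') == (b a == b a')].
pose F w := [ffun a => cell (Y a w)].
have FE f : F @^-1` [set f] = [set w | forall a, cell (Y a w) = f a].
  apply/seteqP; split => w /=.
    by move=> <- a; rewrite ffunE.
  by move=> h; apply/ffunP => a; rewrite ffunE.
have mF f : measurable (F @^-1` [set f]).
  rewrite (_ : _ @^-1` _ = \bigcap_(a in [set: 'I_n]) (Y a @^-1` (cell @^-1` [set f a]))).
    apply: fin_bigcap_measurable => [|a _]; first exact: finite_finset.
    by rewrite -[X in measurable X]setTI; exact: measurable_funPT.
  rewrite FE; apply/seteqP; split => w h a; [move=> _; exact: h|exact: (h a I)].
have -> : [set w | forall a a', (cell (Y a w) == cell (Y a' w)) = (b a == b a')] =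
    [set w | good (F w)].
  apply/seteqP; split => w /= h.
    by apply/forallP => a; apply/forallP => a'; rewrite !ffunE h.
  by move=> a a'; have /forallP/(_ a)/forallP/(_ a')/eqP := h; rewrite !ffunE.
have mgood : measurable [set w | good (F w)].
  have := measurable_fun_cell mF (fun f => (good f)%:R : R).
  move=> /(_ measurableT [set 1] (measurable_set1 1)); rewrite setTI.
  congr measurable; apply/seteqP; split => w /=; case: good => //.
  by move=> /eqP; rewrite eq_sym oner_eq0.
transitivity (\sum_(f | good f) P (F @^-1` [set f]))%E.
  rewrite -[X in P X]setIT -integral_indic//.
  rewrite (eq_integral (fun w => ((good (F w))%:R : R)%:E)); last first.
    move=> w _; rewrite indicE; congr (_%:R%:E); congr nat_of_bool.
    by apply/idP/idP; rewrite inE.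
  rewrite (integral_cell mF P (h := fun f => (good f)%:R))// [RHS]big_mkcond/=.
  by apply: eq_bigr => f _; case: ifP => _; rewrite ?mul1e ?mul0e.
rewrite (reindex_onto (fun f : {ffun 'I_k -> J} => [ffun a => f (b a)])
  (fun g : {ffun 'I_n -> J} => [ffun m => g (s m)]))/=; last first.
  move=> g /forallP gg; apply/ffunP => a; rewrite !ffunE.
  by apply/eqP; have /forallP/(_ a)/eqP -> := gg (s (b a)); rewrite bs.
apply: eq_big => f.
  rewrite (_ : [ffun m => _] = f); last by apply/ffunP => m; rewrite !ffunE bs.
  rewrite eqxx andbT; apply/forallP/injectiveP => [h m m' ff|h a].
    have /forallP/(_ (s m')) := h (s m); rewrite !ffunE !bs ff eqxx.
    by move=> /eqP/esym/eqP.
  by apply/forallP => a'; rewrite !ffunE (inj_eq h).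
move=> /andP [hg _].
have f_inj : injective f.
  move=> m m' ff; have /forallP/(_ (s m))/forallP/(_ (s m')) := hg.
  by rewrite !ffunE !bs ff eqxx => /eqP/esym/eqP.
rewrite FE.
rewrite -(conditionally_iid_cells rho_meas rho_ge0 rho_fin rho_inf c_gt0 Pt_law n_gt0
  Y_iid cell_meas b f_inj).
by congr (P _); apply/seteqP; split => w /= h a; have := h a; rewrite ffunE.
Qed.

(** * Refining cells on a Polish space *)

(** The balls of radius [1 / (r + 1)] around the points of a countable dense set separate points. *)
Lemma polish_separating (R : realType) (X : ptopologicalType) : polish R X ->
  exists2 U : nat -> set X, (forall i, open (U i)) &
    forall x y, x <> y -> exists2 i, U i x & ~ U i y.
Proof.
case=> -[S /countable_injP [e einj] dS] [dist [d0 dE dC dT dN] _].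
(* Codes [e x = i] index the centres by [nat]; as [e] is injective on [S], each [V i r] is one ball
   or empty. *)
pose V i r := [set y | exists x, [/\ S x, e x = i & dist x y < r.+1%:R^-1]].
have Vo i r : open (V i r).
  rewrite openE => y [x [Sx ei xy]]; apply/dN.
  exists (r.+1%:R^-1 - dist x y); first by rewrite subr_gt0.
  move=> z /= yz; exists x; split => //.
  by apply: le_lt_trans (dT x y z) _; rewrite -ltrBrDl.
pose U k := if unpickle k is Some p then V p.1 p.2 else set0.
exists U => [k|x y xy].
  rewrite /U; case: unpickle => [p|]; [exact: Vo|exact: open0].
have dxy : 0 < dist x y by rewrite lt_neqAle d0 andbT; apply/eqP => /esym/dE.
(* Twice the radius is at most the distance, so no ball of this radius contains both points. *)
have [r hr] : exists r, 2 * r.+1%:R^-1 <= dist x y.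
  exists (Num.bound (2 / dist x y)); rewrite ler_pdivrMr// -ler_pdivrMl//.
  rewrite mulrC ltW// (lt_trans (archi_boundP _))// ?ltr_nat//.
  by rewrite divr_ge0// ltW.
have [s [Bs Ss]] : [set z | dist x z < r.+1%:R^-1]^° `&` S !=set0.
  apply: dS; last exact: open_interior.
  exists x; apply/dN; exists r.+1%:R^-1 => //; by rewrite invr_gt0.
have {}Bs : dist x s < r.+1%:R^-1 by apply: interior_subset Bs.
exists (pickle (e s, r)).
  by rewrite /U pickleK /=; exists s; split => //; rewrite dC.
rewrite /U pickleK /= => -[s' [Ss' es' s'y]].
have ss : s' = s by apply: einj; rewrite ?inE.
have := dT x s y; rewrite leNgt => /negP; apply.
by apply: lt_le_trans hr; rewrite mulr_natl mulr2n ltrD// -ss.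
Qed.

Section cells.
Context (R : realType) (X : ptopologicalType) (U : nat -> set X).
Hypothesis U_open : forall i, open (U i).
Hypothesis U_sep : forall x y, x <> y -> exists2 i, U i x & ~ U i y.
Variable x0 : X.

(* x0 gets a cell of its own, so that its mass is the same at every level. *)
Definition cell N (x : borel X) : option {ffun 'I_N -> bool} :=
  if x == x0 then None else Some [ffun i : 'I_N => `[< U i x >]].

Lemma measurable_base i : measurable (U i : set (borel X)).
Proof. by apply: sub_sigma_algebra; exact: U_open. Qed.

Lemma cell_eqP N (x y : X) : cell N x = cell N y <->
  (x = x0 <-> y = x0) /\ (x <> x0 -> forall i : 'I_N, U i x <-> U i y).
Proof.
rewrite /cell; case: eqVneq => [xx|/eqP xx]; case: eqVneq => [yy|/eqP yy].
- by split.
- by split => // -[[/(_ xx)]].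
- by split => // -[[_ /(_ yy)]].
- split => [[/ffunP h]|[_ h]].
    split => // _ i; have := h i; rewrite !ffunE => e.
    by split => /asboolP; [rewrite e|rewrite -e] => /asboolP.
  congr Some; apply/ffunP => i; rewrite !ffunE.
  by apply/asbool_equiv_eq; exact: h.
Qed.

Lemma cell_None N : cell N @^-1` [set None] = [set x0].
Proof.
apply/seteqP; split => x /=; rewrite /cell; first by case: eqVneq.
by move=> ->; rewrite eqxx.
Qed.

(** A point is the countable intersection of the [U i] that contain it and the complements of the
    others; hence [x0] can be a cell. *)
Lemma measurable_separated_set1 (x : X) : measurable ([set x] : set (borel X)).
Proof.
rewrite (_ : [set x] = \bigcap_i (if `[< U i x >] then U i else ~` U i)).
  apply: bigcapT_measurable => i; case: asboolP => _.
    exact: measurable_base.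
  by apply: measurableC; exact: measurable_base.
apply/seteqP; split => [y -> i _|y h /=].
  by case: asboolP.
apply: contrapT => yx; have [i Uy nUx] := U_sep yx.
have := h i I; case: asboolP => // Ux.
Qed.

Lemma measurable_cell N o : measurable (cell N @^-1` [set o]).
Proof.
case: o => [g|]; last first.
  by rewrite cell_None; exact: measurable_separated_set1.
rewrite (_ : _ @^-1` _ = ~` [set x0] `&`
    \bigcap_(i in [set: 'I_N]) (if g i then U i else ~` U i)).
  apply: measurableI; first by apply: measurableC; exact: measurable_separated_set1.
  apply: fin_bigcap_measurable => [|i _]; first exact: finite_finset.
  by case: (g i); [|apply: measurableC]; exact: measurable_base.
apply/seteqP; split => x /=; rewrite /cell; case: eqVneq => [|/eqP xx] //.
- move=> [<-]; split => // i _ /=; rewrite ffunE.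
  by case: asboolP.
- by move=> xx [/(_ xx)].
- move=> [_ h]; congr Some; apply/ffunP => i; rewrite ffunE.
  by have := h i I; case: (g i) => // ?; apply/asboolP.
Qed.

Lemma cell_mono N M (x y : X) : (N <= M)%N -> cell M x = cell M y -> cell N x = cell N y.
Proof.
move=> NM /cell_eqP[h1 h2]; apply/cell_eqP; split => // xx i.
exact: (h2 xx (widen_ord NM i)).
Qed.

Lemma cell_separates (x y : X) : x <> y -> exists N, forall M, (N <= M)%N ->
  cell M x <> cell M y.
Proof.
move=> xy; have [i Ux Uy] := U_sep xy.
have [j Vy Vx] := U_sep (fun e => xy (esym e)).
exists (maxn i j).+1 => M NM /cell_eqP[h1 h2].
have iM : (i < M)%N by rewrite (leq_trans _ NM)// ltnS leq_maxl.
have [xx|xx] := pselect (x = x0); first by apply: xy; rewrite xx (h1.1 xx).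
by apply: Uy; apply/(h2 xx (Ordinal iM)).
Qed.

Lemma bigcap_cell (x : X) : \bigcap_N (cell N @^-1` [set cell N x]) = [set x].
Proof.
apply/seteqP; split => [y h /=|y -> //].
apply: contrapT => yx; have [N hN] := cell_separates yx.
exact: (hN N (leqnn N) (h N I)).
Qed.

Variable nu : probability (borel X) R.
Hypothesis nu_diffuse : forall x : X, nu [set x] = 0%E.

Definition cell_prob N o : R := fine (nu (cell N @^-1` [set o])).

Arguments cell_prob N o : clear implicits.

Lemma cell_probE N o : (cell_prob N o)%:E = nu (cell N @^-1` [set o]).
Proof. by rewrite fineK//; apply: fin_num_measure; exact: measurable_cell. Qed.

Lemma cell_prob_ge0 N o : 0 <= cell_prob N o.
Proof. exact: fine_ge0. Qed.

Lemma cell_prob_None N : cell_prob N None = 0.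
Proof. by rewrite /cell_prob cell_None nu_diffuse. Qed.

Lemma sum_cell_prob N : \sum_o cell_prob N o = 1.
Proof.
apply: EFin_inj; rewrite -sumEFin -(probability_setT nu).
rewrite (measure_cell_sum (@measurable_cell N)).
by apply: eq_bigr => o _; rewrite cell_probE.
Qed.

(** The sum is the integral against [nu] of the mass of the cell containing [x]. That mass is at
    most 1 and decreases to [nu [set x] = 0] by continuity from above. *)
Lemma cvg_sum_cell_prob2 :
  \sum_o cell_prob N o ^+ 2 @[N --> \oo] --> (0 : R).
Proof.
have intE N : (\int[nu]_x (cell_prob N (cell N x))%:E = (\sum_o cell_prob N o ^+ 2)%:E)%E.
  rewrite (integral_cell (@measurable_cell N))//; last exact: cell_prob_ge0.
  rewrite -sumEFin; apply: eq_bigr => o _.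
  by rewrite expr2 EFinM; congr (_ * _)%E; rewrite cell_probE.
have cvgE : (\int[nu]_x (cell_prob N (cell N x))%:E @[N --> \oo] --> \int[nu]_x (0%E : \bar R))%E.
  apply: (@dominated_cvg _ _ _ nu setT measurableT _ _ (fun=> 1%E)) => //.
  - move=> N; apply/measurable_EFinP.
    exact: (measurable_fun_cell (@measurable_cell N)).
  - move=> x _; rewrite -(nu_diffuse x) -bigcap_cell.
    rewrite (_ : (fun N => _) = (fun N => nu (cell N @^-1` [set cell N x]))).
      apply: nonincreasing_cvg_mu.
      + by rewrite -ge0_fin_numE//; apply: fin_num_measure; exact: measurable_cell.
      + by move=> N; exact: measurable_cell.
      + by rewrite bigcap_cell; exact: measurable_separated_set1.
      + move=> N M NM; apply/subsetPset => y /=; exact: cell_mono.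
    by apply/funext => N; rewrite cell_probE.
  - exact: finite_measure_integrable_cst.
  - move=> N x _; rewrite gee0_abs ?lee_fin ?cell_prob_ge0//.
    by rewrite -lee_fin cell_probE; apply: probability_le1; exact: measurable_cell.
move: cvgE; rewrite integral0; under eq_fun do rewrite intE.
by move=> /fine_cvgP[_].
Qed.

Lemma measurable_cell_tie d (Omega : measurableType d) n (k : nat)
    (Y : 'I_n -> {mfun Omega >-> borel X}) (b : 'I_n -> 'I_k) N :
  measurable [set w | forall a a',
    (cell N (Y a w) == cell N (Y a' w)) = (b a == b a')].
Proof.
pose T a a' := [set w | cell N (Y a w) = cell N (Y a' w)].
have mT a a' : measurable (T a a').
  rewrite (_ : T a a' = \bigcup_(o in setT) ((Y a @^-1` (cell N @^-1` [set o])) `&`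
      (Y a' @^-1` (cell N @^-1` [set o])))).
    apply: fin_bigcup_measurable => [|o _]; first exact: finite_finset.
    by apply: measurableI; rewrite -[X in measurable X]setTI;
      apply: measurable_funPT => //; exact: measurable_cell.
  apply/seteqP; split => w /=; first by move=> e; exists (cell N (Y a w)).
  by case=> g _ [] /= e1 e2; rewrite /T /= e1 e2.
rewrite (_ : [set w | _] = \bigcap_(p in [set: 'I_n * 'I_n])
    (if b p.1 == b p.2 then T p.1 p.2 else ~` T p.1 p.2)).
  apply: fin_bigcap_measurable => [|p _]; first exact: finite_finset.
  by case: ifP => _ //; apply: measurableC.
apply/seteqP; split => w /=.
  move=> h [a a'] _ /=; have := h a a'; case: (b a == b a').
    by move/eqP.
  by move/negbT/eqP.
move=> h a a'; have /= := h (a, a') I; case: (b a == b a') => [|] e.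
  by apply/eqP.
by apply/negbTE/eqP.
Qed.

(** Only finitely many pairs have to be separated, so for each outcome the cell ties agree with the
    true ties from some level on, and the indicators converge pointwise. *)
Lemma cvg_cell_tie d (Omega : measurableType d) (P : probability Omega R) n (k : nat)
    (Y : 'I_n -> {mfun Omega >-> borel X}) (b : 'I_n -> 'I_k) :
  P [set w | forall a a', (cell N (Y a w) == cell N (Y a' w)) = (b a == b a')]
    @[N --> \oo] -->
  P [set w | forall a a', ((Y a w : X) == Y a' w) = (b a == b a')].
Proof.
pose S N := [set w | forall a a', (cell N (Y a w) == cell N (Y a' w)) = (b a == b a')].
pose E := [set w | forall a a', ((Y a w : X) == Y a' w) = (b a == b a')].
have mS N : measurable (S N) by exact: measurable_cell_tie.
have ev w : exists N, forall M, (N <= M)%N -> S M w <-> E w.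
  have /choice[f hf] : forall p : 'I_n * 'I_n, exists N, forall M, (N <= M)%N ->
      (cell M (Y p.1 w) == cell M (Y p.2 w)) = ((Y p.1 w : X) == Y p.2 w).
    move=> [a a'] /=; have [e|ne] := eqVneq (Y a w : X) (Y a' w).
      by exists 0%N => M _; rewrite e eqxx.
    move/eqP: ne => /cell_separates[N hN]; exists N => M NM.
    by apply/negbTE/eqP; exact: hN.
  exists (\max_p f p) => M NM.
  have fM p : (f p <= M)%N by rewrite (leq_trans _ NM)// leq_bigmax.
  by split => h a a'; have := hf (a, a') M (fM _); rewrite /= => e;
    have := h a a'; rewrite e.
(* [E] is the lower limit of the [S N]; its measurability is read off from this, without the
   diagonal of the product space. *)
have EE : E = \bigcup_N \bigcap_(M in [set M | (N <= M)%N]) S M.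
  apply/seteqP; split => w.
    by move=> Ew; have [N hN] := ev w; exists N => // M /= NM; apply/hN.
  move=> [N _ h]; have [N' hN'] := ev w.
  by apply/(hN' (maxn N N') (leq_maxr _ _)); apply: h; rewrite /= leq_maxl.
have mE : measurable E.
  rewrite EE; apply: bigcupT_measurable => N.
  by apply: bigcap_measurable => [|M _]; [exists N => /=|exact: mS].
have intE A : measurable A -> P A = (\int[P]_w (\1_A w)%:E)%E.
  by move=> mA; rewrite integral_indic// setIT.
rewrite -/E (intE E mE).
rewrite (_ : (fun N => _) = (fun N => \int[P]_w (\1_(S N) w)%:E))%E; last first.
  by apply/funext => N; rewrite -intE.
apply: (@dominated_cvg _ _ _ P setT measurableT _ _ (fun=> 1%E)) => //.
- by move=> N; apply/measurable_EFinP.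
- move=> w _; have [N hN] := ev w; apply: cvg_near_cst.
  exists N => // M /= NM; rewrite !indicE; congr (_%:R%:E); congr nat_of_bool.
  by apply/idP/idP; rewrite !inE => ?; apply/(hN M NM).
- exact: finite_measure_integrable_cst.
- by move=> N w _; rewrite gee0_abs ?lee_fin// indicE; case: (_ \in _); rewrite ?lexx ?ler01.
Qed.

End cells.

(** * Sums over injective assignments *)

Section injective_sums.
Context {R : realFieldType} (O : finType) (o0 : O) (k : nat) (W : 'I_k -> O -> R).
Hypothesis W_ge0 : forall m o, 0 <= W m o.

Let w (f : {ffun 'I_k -> O}) := \prod_m W m (f m).

Let w_ge0 f : 0 <= w f.
Proof. exact: prodr_ge0. Qed.

Let avoid (f : {ffun 'I_k -> O}) := [forall m, f m != o0].

Let hit l (f : {ffun 'I_k -> O}) :=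
  [forall m, if m == l then f m == o0 else f m != o0].

Let sum_avoid : \sum_(f | avoid f) w f = \prod_m \sum_(o | o != o0) W m o.
Proof.
rewrite bigA_distr_big; apply: eq_bigl => f.
by apply/forallP/ffun_onP => h m; exact: h.
Qed.

Let sum_hit l : \sum_(f | hit l f) w f =
  W l o0 * \prod_(m | m != l) \sum_(o | o != o0) W m o.
Proof.
pose Q m o := if m == l then o == o0 else o != o0.
transitivity (\prod_m \sum_(o | Q m o) W m o).
  rewrite (bigA_distr_big_dep Q).
  by apply: eq_bigl => f; apply/forallP/familyP => h m; exact: h.
rewrite (bigD1 l)//=; congr (_ * _).
  by rewrite /Q eqxx big_pred1_eq.
by apply: eq_bigr => m /negPf ml; apply: eq_bigl => o; rewrite /Q ml.
Qed.

(** Only repetitions away from [o0] matter: an assignment that takes [o0] twice is counted neither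
    by [avoid] nor by any [hit l]. *)
Let coll m m' (f : {ffun 'I_k -> O}) := (f m == f m') && (f m != o0).

Let sum_coll m m' : m' != m -> \sum_(f | coll m m' f) w f =
  (\sum_(o | o != o0) W m o * W m' o) *
  \prod_(r | (r != m) && (r != m')) \sum_o W r o.
Proof.
move=> mm'; rewrite mulr_suml.
rewrite (partition_big (fun f : {ffun 'I_k -> O} => f m) (fun o => o != o0))/=; last first.
  by move=> f /andP[].
apply: eq_bigr => o oo0.
pose Q r o' := if (r == m) || (r == m') then o' == o else true.
transitivity (\prod_r \sum_(o' | Q r o') W r o').
  rewrite (bigA_distr_big_dep Q).
  apply: eq_bigl => f; apply/idP/familyP => [|h].
    move=> /andP[/andP[/eqP fm _] /eqP fo] r.
    change (Q r (f r)); rewrite /Q.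
    case: (r =P m) => [->|_] /=; first by rewrite fo.
    by case: (r =P m') => [->|//]; rewrite -fm fo.
  have : Q m (f m) by exact: h.
  have : Q m' (f m') by exact: h.
  rewrite /Q !eqxx orbT/= => /eqP h' /eqP h''.
  by rewrite /coll h' h'' !eqxx oo0.
rewrite (bigD1 m)//= (bigD1 m')//= mulrA; congr (_ * _ * _).
- by rewrite /Q eqxx big_pred1_eq.
- by rewrite /Q eqxx orbT big_pred1_eq.
- apply: eq_bigr => r /andP[/negPf rm /negPf rm'].
  by apply: eq_bigl => o'; rewrite /Q rm rm'.
Qed.

Let main := \prod_m \sum_(o | o != o0) W m o +
  \sum_l W l o0 * \prod_(m | m != l) \sum_(o | o != o0) W m o.

(* Expanding the products, main counts every injective f exactly once, and a
   non-injective f at most k.+1 times and only if it repeats a value other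
   than o0; coll bounds the latter. *)
Let cnt (f : {ffun 'I_k -> O}) : nat := (avoid f + \sum_l hit l f)%N.

Let mainE : main = \sum_f (cnt f)%:R * w f.
Proof.
rewrite /main -sum_avoid; under [X in _ + X]eq_bigr do rewrite -sum_hit.
under [in RHS]eq_bigr do rewrite natrD mulrDl natr_sum mulr_suml.
rewrite big_split/= exchange_big/=; congr (_ + _).
  by rewrite big_mkcond; apply: eq_bigr => f _; case: (avoid f); rewrite ?mul1r ?mul0r.
apply: eq_bigr => l _.
by rewrite big_mkcond; apply: eq_bigr => f _; case: (hit l f); rewrite ?mul1r ?mul0r.
Qed.

Let cnt_inj (f : {ffun 'I_k -> O}) : injectiveb f -> cnt f = 1%N.
Proof.
move=> /injectiveP f_inj; rewrite /cnt.
have [av|] := boolP (avoid f).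
  rewrite big1// => l _; apply/eqP; rewrite eqb0; apply/negP => /forallP/(_ l).
  by rewrite eqxx; apply/negP; have /forallP := av.
rewrite negb_forall => /existsP[l0]; rewrite negbK => /eqP fl0.
rewrite (bigD1 l0)//= big1 => [|l ll0].
  rewrite addn0; apply/eqP; rewrite eqb1; apply/forallP => m.
  by case: eqVneq => [->|ml0]; [rewrite fl0|rewrite -fl0 inj_eq].
apply/eqP; rewrite eqb0; apply/negP => /forallP/(_ l0).
by rewrite eq_sym (negPf ll0) fl0 eqxx.
Qed.

Let cnt_noninj (f : {ffun 'I_k -> O}) : ~~ injectiveb f ->
  (cnt f <= k.+1 * \sum_m \sum_(m' | m' != m) coll m m' f)%N.
Proof.
move=> /injectivePn[m [m' mm' fmm']].
have [-> //|cf] := posnP (cnt f).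
have fm : f m != o0.
  apply/negP => /eqP fm0; move: cf; rewrite /cnt lt0n => /negP; apply.
  rewrite addn_eq0; apply/andP; split.
    by rewrite eqb0; apply/negP => /forallP/(_ m); rewrite fm0 eqxx.
  rewrite sum_nat_eq0; apply/forallP => l /=; rewrite eqb0.
  apply/negP => /forallP h; have := h m; have := h m'; rewrite -fmm' fm0 eqxx.
  case: eqVneq => // m'l _; case: eqVneq => // ml _.
  by move: mm'; rewrite ml m'l eqxx.
have c1 : (cnt f <= k.+1)%N.
  rewrite /cnt -add1n leq_add ?leq_b1// -[leqRHS]card_ord -sum1_card leq_sum// => l _.
  exact: leq_b1.
apply: (leq_trans c1); rewrite leq_pmulr//.
rewrite (bigD1 m)//= (bigD1 m')//=; last by rewrite eq_sym.
by rewrite /coll fmm' eqxx -fmm' fm.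
Qed.

(** In [main] minus the injective sum, [w f] has coefficient [cnt f] for non-injective [f] and 0
    otherwise, so the difference is nonnegative and [cnt_noninj] bounds it by the sum over colliding
    pairs. The factor [k.+1] is the number of terms in [cnt]. *)
Lemma injective_sum_bound :
  `|\sum_(f : {ffun 'I_k -> O} | injectiveb f) \prod_m W m (f m) -
    (\prod_m \sum_(o | o != o0) W m o +
     \sum_l W l o0 * \prod_(m | m != l) \sum_(o | o != o0) W m o)| <=
  k.+1%:R * \sum_m \sum_(m' | m' != m) (\sum_(o | o != o0) W m o * W m' o) *
    \prod_(r | (r != m) && (r != m')) \sum_o W r o.
Proof.
rewrite -/main mainE distrC [X in _ - X]big_mkcond -sumrB.
rewrite ger0_norm; last first.
  apply: sumr_ge0 => f _; case: ifPn => [/cnt_inj ->|_]; first by rewrite mul1r subrr.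
  by rewrite subr0 mulr_ge0.
rewrite mulr_sumr.
have -> : \sum_m k.+1%:R * (\sum_(m' | m' != m)
    (\sum_(o | o != o0) W m o * W m' o) *
    \prod_(r | (r != m) && (r != m')) \sum_o W r o) =
  \sum_f (k.+1 * \sum_m \sum_(m' | m' != m) coll m m' f)%:R * w f.
  under [in RHS]eq_bigr do rewrite natrM natr_sum mulr_sumr mulr_suml.
  rewrite exchange_big/=; apply: eq_bigr => m _.
  rewrite mulr_sumr; under [in RHS]eq_bigr do rewrite natr_sum mulr_sumr mulr_suml.
  rewrite exchange_big/=; apply: eq_bigr => m' mm'.
  rewrite -sum_coll// mulr_sumr big_mkcond; apply: eq_bigr => f _.
  by case: (coll m m' f); rewrite ?mulr1 ?mulr0 ?mul0r.
apply: ler_sum => f _; case: ifPn => [/cnt_inj ->|/cnt_noninj h].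
  by rewrite mul1r subrr mulr_ge0.
by rewrite subr0 ler_wpM2r// ler_nat.
Qed.

End injective_sums.

Lemma cvg_finite_sum (R : realType) (I : Type) (r : seq I) (P : pred I)
    (u : I -> R ^nat) (l : I -> R) :
  (forall i, P i -> u i N @[N --> \oo] --> l i) ->
  \sum_(i <- r | P i) u i N @[N --> \oo] --> \sum_(i <- r | P i) l i.
Proof. by move=> h; apply: cvg_big => //; exact: add_continuous. Qed.

Lemma cvg_finite_prod (R : realType) (I : Type) (r : seq I) (P : pred I)
    (u : I -> R ^nat) (l : I -> R) :
  (forall i, P i -> u i N @[N --> \oo] --> l i) ->
  \prod_(i <- r | P i) u i N @[N --> \oo] --> \prod_(i <- r | P i) l i.
Proof. by move=> h; apply: cvg_big => //; exact: mul_continuous. Qed.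

Section injective_sum_limit.
Context {R : realType} (O : nat -> finType) (o0 : forall N, O N) (q : forall N, O N -> R).
Arguments q : clear implicits.
Hypothesis q_ge0 : forall N o, 0 <= q N o.
Hypothesis q_sqr : \sum_o q N o ^+ 2 @[N --> \oo] --> (0 : R).

(** A collision sum is at most [C m * C m'] times the sum of the [q ^ 2], while the remaining
    factors converge; so the error [Er] vanishes and the limit is that of the main part [A]. *)
Lemma cvg_injective_sum k (W : forall N, 'I_k -> O N -> R) (z beta : 'I_k -> R)
    (C : 'I_k -> R) :
  (forall m, 0 <= C m) -> (forall N m o, 0 <= W N m o) ->
  (forall N m, W N m (o0 N) = z m) ->
  (forall N m o, o != o0 N -> W N m o <= C m * q N o) ->
  (forall m, \sum_(o | o != o0 N) W N m o @[N --> \oo] --> beta m) ->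
  \sum_(f : {ffun 'I_k -> O N} | injectiveb f) \prod_m W N m (f m) @[N --> \oo] -->
  \prod_m beta m + \sum_l z l * \prod_(m | m != l) beta m.
Proof.
move=> C0 W0 Wz WC Wbeta.
pose A N := \prod_m \sum_(o | o != o0 N) W N m o +
  \sum_l W N l (o0 N) * \prod_(m | m != l) \sum_(o | o != o0 N) W N m o.
pose S N := \sum_(f : {ffun 'I_k -> O N} | injectiveb f) \prod_m W N m (f m).
pose Er N := k.+1%:R * \sum_m \sum_(m' | m' != m)
    (\sum_(o | o != o0 N) W N m o * W N m' o) *
    \prod_(r | (r != m) && (r != m')) \sum_o W N r o.
have cA : A N @[N --> \oo] --> \prod_m beta m + \sum_l z l * \prod_(m | m != l) beta m.
  apply: cvgD; first exact: cvg_finite_prod.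
  apply: cvg_finite_sum => l _; apply: cvgM; last exact: cvg_finite_prod.
  by under eq_fun do rewrite Wz; exact: cvg_cst.
have cWW m m' : \sum_(o | o != o0 N) W N m o * W N m' o @[N --> \oo] --> (0 : R).
  apply: (@squeeze_cvgr _ _ _ _ (fun=> 0) (fun N => C m * C m' * \sum_o q N o ^+ 2)).
  - apply: nearW => N; rewrite sumr_ge0 => [/=|o _]; last by rewrite mulr_ge0.
    have CW i o : o != o0 N -> 0 <= C i * q N o.
      by move=> oo; apply: le_trans (WC N i o oo).
    rewrite mulr_sumr [leRHS](bigID (fun o => o != o0 N))/=.
    have h : \sum_(o | o != o0 N) W N m o * W N m' o <=
        \sum_(o | o != o0 N) C m * C m' * q N o ^+ 2.
      by apply: ler_sum => o oo; rewrite expr2 mulrACA ler_pM ?WC.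
    apply: le_trans h _; rewrite lerDl sumr_ge0// => o _.
    by rewrite !mulr_ge0 ?exprn_ge0.
  - exact: cvg_cst.
  - by rewrite -[X in _ --> X](mulr0 (C m * C m')); apply: cvgMr.
have cEr : Er N @[N --> \oo] --> (0 : R).
  suff : Er N @[N --> \oo] --> k.+1%:R * \sum_m \sum_(m' | m' != m)
      0 * \prod_(r | (r != m) && (r != m')) (z r + beta r).
    rewrite big1 ?mulr0// => m _; rewrite big1// => m' _; exact: mul0r.
  apply: cvgMr; apply: cvg_finite_sum => m _; apply: cvg_finite_sum => m' _.
  apply: cvgM => //; apply: cvg_finite_prod => r _.
  under eq_fun do rewrite (bigD1 (o0 _))//= Wz.
  by apply: cvgD => //; exact: cvg_cst.
change (S @ \oo --> \prod_m beta m + \sum_l z l * \prod_(m | m != l) beta m).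
have -> : S = (fun N => A N + (S N - A N)) by apply/funext => N; rewrite addrC subrK.
rewrite -[X in _ --> X]addr0; apply: cvgD => //.
apply: (@squeeze_cvgr _ _ _ _ (fun N => - Er N) Er) => //.
  apply: nearW => N; rewrite -ler_norml.
  by apply: injective_sum_bound => m o; exact: W0.
by rewrite -oppr0; exact: cvgN.
Qed.

End injective_sum_limit.

(** * Scaling bounds for the generating polynomials *)

Section bell_gen_bounds.
Context {R : realType} (rho : R -> R).
Hypothesis rho_meas : measurable_fun (`]0, +oo[%classic : set R) rho.
Hypothesis rho_ge0 : forall s, 0 < s -> 0 <= rho s.
Hypothesis rho_fin : (\int[lebesgue_measure]_(s in `]0%R, +oo[)
                  (Num.min 1 s * rho s)%:E < +oo)%E.

Lemma bell_genS n a u : 0 < u ->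
  bell_gen rho n.+1 a u =
  a * tau rho n.+1 u + \sum_(i < n) a ^+ i.+2 * bell rho n.+1 i.+2 u.
Proof.
move=> u0; rewrite /bell_gen big_ord_recl/= bellS0// mulr0 add0r.
by rewrite big_ord_recl/= bell1// expr1.
Qed.

Lemma bell_gen_ge0 n a u : 0 < u -> 0 <= a -> 0 <= bell_gen rho n a u.
Proof.
move=> u0 a0; apply: sumr_ge0 => i _.
by rewrite mulr_ge0 ?exprn_ge0//; exact: bell_ge0.
Qed.

(** The linear term scales exactly; every other one carries a power [y ^ i] with [i >= 2], at most
    [y ^ 2]. *)
Lemma bell_gen_shrink n c y u : 0 < u -> 0 <= c -> 0 <= y <= 1 ->
  0 <= bell_gen rho n.+1 (c * y) u - y * (c * tau rho n.+1 u) <=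
  y ^+ 2 * bell_gen rho n.+1 c u.
Proof.
move=> u0 c0 /andP[y0 y1]; rewrite bell_genS//.
have -> : c * y * tau rho n.+1 u = y * (c * tau rho n.+1 u) by ring.
have ci i : 0 <= c ^+ i * bell rho n.+1 i u.
  by rewrite mulr_ge0 ?exprn_ge0//; exact: bell_ge0.
rewrite addrC addKr sumr_ge0/=; last first.
  move=> i _; rewrite exprMn mulrAC mulr_ge0// exprn_ge0//.
rewrite bell_genS// mulrDr (@le_trans _ _ (y ^+ 2 *
    \sum_(i < n) c ^+ i.+2 * bell rho n.+1 i.+2 u))//; last first.
  by rewrite lerDr mulr_ge0 ?exprn_ge0// mulr_ge0//; exact: tau_ge0.
rewrite mulr_sumr; apply: ler_sum => i _.
rewrite exprMn mulrAC mulrC ler_wpM2r// -addn2 exprD ler_piMl ?exprn_ge0//.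
by rewrite exprn_ile1.
Qed.

(** There is no constant term, so a factor [y] comes out of every monomial. *)
Lemma bell_gen_le n c y u : 0 < u -> 0 <= c -> 0 <= y <= 1 ->
  bell_gen rho n.+1 (c * y) u <= y * bell_gen rho n.+1 c u.
Proof.
move=> u0 c0 /andP[y0 y1]; rewrite !bell_genS// mulrDr.
have -> : c * y * tau rho n.+1 u = y * (c * tau rho n.+1 u) by ring.
rewrite lerD//.
rewrite mulr_sumr; apply: ler_sum => i _.
rewrite exprMn mulrAC mulrC ler_wpM2r//.
  by rewrite mulr_ge0 ?exprn_ge0//; exact: bell_ge0.
by rewrite exprS ler_piMr// exprn_ile1.
Qed.

(** The degree is at most [n] and [y ^ n <= y ^ i] for [i <= n]. This converse estimate lets a
    single level control the dominating function. *)
Lemma bell_gen_ge n c y u : 0 < u -> 0 <= c -> 0 < y <= 1 ->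
  bell_gen rho n c u <= y ^- n * bell_gen rho n (c * y) u.
Proof.
move=> u0 c0 /andP[y0 y1]; rewrite ler_pdivlMl ?exprn_gt0//.
rewrite /bell_gen mulr_sumr; apply: ler_sum => i _.
have -> : (c * y) ^+ i * bell rho n i u = y ^+ i * (c ^+ i * bell rho n i u).
  by rewrite exprMn; ring.
rewrite ler_wpM2r//.
  by rewrite mulr_ge0 ?exprn_ge0//; exact: bell_ge0.
by apply: ler_wiXn2l => //; [exact: ltW|rewrite -ltnS].
Qed.

End bell_gen_bounds.

(** * Passage to the limit *)

Section eppf_limit.
Context {R : realType} (rho : R -> R).
Hypothesis rho_meas : measurable_fun (`]0, +oo[%classic : set R) rho.
Hypothesis rho_ge0 : forall s, 0 < s -> 0 <= rho s.
Hypothesis rho_fin : (\int[lebesgue_measure]_(s in `]0%R, +oo[)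
                  (Num.min 1 s * rho s)%:E < +oo)%E.
Context (O : nat -> finType) (o0 : forall N, O N) (q : forall N, O N -> R).
Arguments q : clear implicits.
Hypothesis q_ge0 : forall N o, 0 <= q N o.
Hypothesis q_o0 : forall N, q N (o0 N) = 0.
Hypothesis q_sum : forall N, \sum_o q N o = 1.
Hypothesis q_sqr : \sum_o q N o ^+ 2 @[N --> \oo] --> (0 : R).
Context (zeta c : R) (k n : nat) (ns : 'I_k -> nat).
Hypothesis zeta01 : 0 < zeta < 1.
Hypothesis c_gt0 : 0 < c.
Hypothesis ns_gt0 : forall m, (0 < ns m)%N.

(** [q] stands for the cell masses of the diffuse part, [p] for those of [P0]. *)
Let p N o := zeta * (o == o0 N)%:R + (1 - zeta) * q N o.
Arguments p : clear implicits.

Let zeta1 : 0 < 1 - zeta.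
Proof. by rewrite subr_gt0; case/andP: zeta01. Qed.

Let zeta0 : 0 < zeta.
Proof. by case/andP: zeta01. Qed.

Let q_le1 N o : q N o <= 1.
Proof. by rewrite -(q_sum N) (bigD1 o)//= lerDl sumr_ge0. Qed.

Let sum_q N : \sum_(o | o != o0 N) q N o = 1.
Proof. by rewrite -(q_sum N) [RHS](bigD1 (o0 N))//= q_o0 add0r. Qed.

Let p_o0 N : p N (o0 N) = zeta.
Proof. by rewrite /p eqxx mulr1 q_o0 mulr0 addr0. Qed.

Let p_neq N o : o != o0 N -> p N o = (1 - zeta) * q N o.
Proof. by move=> /negPf; rewrite /p => ->; rewrite mulr0 add0r. Qed.

Let p01 N o : 0 <= p N o <= 1.
Proof.
rewrite /p; apply/andP; split.
  by rewrite addr_ge0// mulr_ge0// ltW.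
have [->|_] := eqVneq o (o0 N).
  by rewrite q_o0 mulr1 mulr0 addr0; case/andP: zeta01 => _ /ltW.
rewrite mulr0 add0r mulr_ile1 ?(ltW zeta1)//.
by rewrite gerBl ltW.
Qed.

Let p_sum N : \sum_o p N o = 1.
Proof.
rewrite big_split/= -!mulr_sumr q_sum (bigD1 (o0 N))//= eqxx big1 => [|o /negPf ->//].
by rewrite addr0 !mulr1 addrC subrK.
Qed.

Let h N u := \sum_(f : {ffun 'I_k -> O N} | injectiveb f)
  \prod_m bell_gen rho (ns m) (c * p N (f m)) u.

Let hlim u := \prod_m ((1 - zeta) * (c * tau rho (ns m) u)) +
  \sum_l bell_gen rho (ns l) (c * zeta) u *
    \prod_(m | m != l) ((1 - zeta) * (c * tau rho (ns m) u)).

Let G m u := bell_gen rho (ns m) c u.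

Let W0 N m o u : 0 < u -> 0 <= bell_gen rho (ns m) (c * p N o) u.
Proof.
move=> u0; apply: bell_gen_ge0 => //.
by rewrite mulr_ge0 ?(ltW c_gt0)//; case/andP: (p01 o).
Qed.

Let G0 m u : 0 < u -> 0 <= G m u.
Proof. by move=> u0; apply: bell_gen_ge0 => //; exact: ltW. Qed.

(** [bell_gen_le] bounds a weight away from [o0] by a multiple of [q], and [bell_gen_shrink]
    linearizes: the weights away from [o0] sum to [(1 - zeta) * (c * tau)] up to a multiple of the
    sum of the [q ^ 2]. *)
Let cvg_h u : 0 < u -> h N u @[N --> \oo] --> hlim u.
Proof.
move=> u0.
have c0 : 0 <= c by exact: ltW.
have nsS m : ns m = (ns m).-1.+1 by rewrite prednK.
apply: (@cvg_injective_sum R O o0 q q_ge0 q_sqr k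
  (fun N m o => bell_gen rho (ns m) (c * p N o) u) _ _ (fun m => (1 - zeta) * G m u)).
- by move=> m; rewrite mulr_ge0 ?G0// ltW.
- by move=> N m o; exact: W0.
- by move=> N m; rewrite p_o0.
- move=> N m o oo; rewrite mulrAC -p_neq// /G nsS.
  exact: bell_gen_le.
- move=> m; pose B N := \sum_(o | o != o0 N) bell_gen rho (ns m) (c * p N o) u.
  have BE N : 0 <= B N - (1 - zeta) * (c * tau rho (ns m) u) <=
      (1 - zeta) ^+ 2 * G m u * \sum_o q N o ^+ 2.
    have -> : (1 - zeta) * (c * tau rho (ns m) u) =
        \sum_(o | o != o0 N) p N o * (c * tau rho (ns m) u).
      by rewrite -mulr_suml (eq_bigr _ (@p_neq N)) -mulr_sumr sum_q mulr1.
    rewrite -sumrB.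
    have hb (o : O N) := bell_gen_shrink rho_meas rho_ge0 rho_fin (ns m).-1 u0 c0 (p01 o).
    rewrite -nsS in hb.
    rewrite sumr_ge0 => [/=|o _]; last by case/andP: (hb o).
    rewrite mulr_sumr [leRHS](bigD1 (o0 N))//= q_o0 expr0n mulr0 add0r.
    apply: ler_sum => o oo; have /andP[_ /le_trans] := hb o; apply.
    by rewrite p_neq// exprMn /G mulrAC.
  change (B @ \oo --> (1 - zeta) * (c * tau rho (ns m) u)).
  rewrite (_ : B = fun N => (1 - zeta) * (c * tau rho (ns m) u) +
      (B N - (1 - zeta) * (c * tau rho (ns m) u))); last first.
    by apply/funext => N; rewrite addrC subrK.
  rewrite -[X in _ --> X]addr0; apply: cvgD; first exact: cvg_cst.
  apply: (squeeze_cvgr (f := fun=> 0) _ (cvg_cst 0)); first by apply: nearW => N; exact: BE.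
  by rewrite -[X in _ --> X](mulr0 ((1 - zeta) ^+ 2 * G m u)); apply: cvgMr.
Qed.

Let h_ge0 N u : 0 < u -> 0 <= h N u.
Proof. by move=> u0; apply: sumr_ge0 => f _; apply: prodr_ge0 => m _; exact: W0. Qed.

(** Each factor is at most [p * G]. Enlarging the sum to all assignments makes it factorize, and the
    [p] sum to 1. *)
Let h_le N u : 0 < u -> h N u <= \prod_m G m u.
Proof.
move=> u0; apply: (@le_trans _ _ (\prod_m \sum_o p N o * G m u)); last first.
  by rewrite le_eqVlt; apply/orP; left; apply/eqP; apply: eq_bigr => m _;
    rewrite -mulr_suml p_sum mul1r.
rewrite bigA_distr_bigA/= [leRHS](bigID (fun f : {ffun 'I_k -> O N} => injectiveb f))/=.
rewrite -[leLHS]addr0 lerD//.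
  apply: ler_sum => f _; apply: ler_prod => m _; rewrite W0//=.
  by rewrite /G -(prednK (ns_gt0 m)) bell_gen_le// ltW.
apply: sumr_ge0 => f _; apply: prodr_ge0 => m _.
by rewrite mulr_ge0 ?G0//; case/andP: (p01 (f m)).
Qed.

(** No assignment is built by hand: [cvg_injective_sum] with weights [p] has a positive limit, so at
    some level one term of the sum is positive. *)
Let exists_pos : exists N, exists2 f : {ffun 'I_k -> O N}, injectiveb f &
  forall m, 0 < p N (f m).
Proof.
have cvgp : \sum_(f : {ffun 'I_k -> O N} | injectiveb f) \prod_m p N (f m)
    @[N --> \oo] --> \prod_(m < k) (1 - zeta) +
      \sum_(l < k) zeta * \prod_(m < k | m != l) (1 - zeta).
  apply: (@cvg_injective_sum R O o0 q q_ge0 q_sqr k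
    (fun N m o => p N o) _ _ (fun m => 1 - zeta)).
  - by move=> m; exact: ltW.
  - by move=> N m o; case/andP: (p01 o).
  - by move=> N m; rewrite p_o0.
  - by move=> N m o oo; rewrite p_neq.
  - move=> m; rewrite (_ : (fun N => _) = (fun=> 1 - zeta)); first exact: cvg_cst.
    by apply/funext => N; rewrite (eq_bigr _ (@p_neq N)) -mulr_sumr sum_q mulr1.
have lim_gt0 : 0 < \prod_(m < k) (1 - zeta) +
    \sum_(l < k) zeta * \prod_(m < k | m != l) (1 - zeta).
  rewrite ltr_wpDr ?prodr_gt0// sumr_ge0// => l _.
  by rewrite mulr_ge0 ?(ltW zeta0)// prodr_ge0// => m _; exact: ltW.
have [N _ /(_ N (leqnn N))] := cvgr_gt _ cvgp _ lim_gt0.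
move=> hN; exists N; apply: contrapT => h0.
move: hN => /=; rewrite big1 ?ltxx// => f finj.
apply/eqP; rewrite prodf_seq_eq0; apply/negPn/negP => /hasPn hf.
apply: h0; exists f => // m; rewrite lt_neqAle eq_sym.
case/andP: (p01 (f m)) => -> _; rewrite andbT.
by have := hf m; rewrite mem_index_enum => /(_ isT).
Qed.

Let w u := u ^+ (n - 1) * expR (- (c * psi rho u)).

Local Notation D := (`]0, +oo[%classic : set R).
Local Notation leb := (@lebesgue_measure R).

Let w0 u : 0 < u -> 0 <= w u.
Proof. by move=> u0; rewrite mulr_ge0 ?expR_ge0// exprn_ge0// ltW. Qed.

Let mw : measurable_fun D w.
Proof.
apply: measurable_funM; first exact: measurable_funX.
apply: measurableT_comp => //; apply: measurableT_comp => //.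
by apply: measurable_funM => //; exact: measurable_psi.
Qed.

Let mbell m a : measurable_fun D (bell_gen rho m a).
Proof.
by apply: measurable_sum => i; apply: measurable_funM => //; exact: measurable_bell.
Qed.

Let mh N : measurable_fun D (h N).
Proof.
have -> : h N = fun u => \sum_(f <- [seq f : {ffun 'I_k -> O N} <- index_enum _ |
    injectiveb f]) \prod_m bell_gen rho (ns m) (c * p N (f m)) u.
  by apply/funext => u; rewrite big_filter.
by apply: measurable_sum => f; apply: measurable_prod => m _; exact: mbell.
Qed.

Let mwh N : measurable_fun D (fun u => (w u * h N u)%:E).
Proof.
apply/measurable_EFinP; apply: measurable_funM; first exact: mw.
exact: mh.
Qed.

(** By [bell_gen_ge], the dominating function is at most [K] times the single term of [w * h N]
    supplied by [exists_pos]; the other terms are nonnegative and the whole has a finite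
    integral. *)
Let integrable_dominating :
  (forall N, (\int[leb]_(u in `]0%R, +oo[) (w u * h N u)%:E < +oo)%E) ->
  leb.-integrable D (fun u => (w u * \prod_m G m u)%:E).
Proof.
move=> fin; have [N [f finj pf]] := exists_pos.
pose K := \prod_m p N (f m) ^- ns m.
apply: (@le_integrable _ _ _ leb D (measurable_pos) _
  (fun u => (K%:E * (w u * h N u)%:E)%E)).
- apply/measurable_EFinP/measurable_funM => //.
  by apply: measurable_prod => m _; exact: mbell.
- move=> u /posP u0; rewrite /= lee_fin ger0_norm; last first.
    by rewrite mulr_ge0 ?w0// prodr_ge0// => m _; exact: G0.
  have K0 : 0 <= K by apply: prodr_ge0 => m _; rewrite invr_ge0 exprn_ge0// ltW.
  rewrite ger0_norm; last by rewrite mulr_ge0// mulr_ge0 ?w0 ?h_ge0.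
  rewrite mulrCA ler_wpM2l ?w0//.
  apply: (@le_trans _ _ (K * \prod_m bell_gen rho (ns m) (c * p N (f m)) u)).
    rewrite -big_split/=; apply: ler_prod => m _; rewrite G0//=.
    apply: bell_gen_ge => //; first exact: ltW.
    by rewrite pf; case/andP: (p01 (f m)).
  rewrite ler_wpM2l// /h (bigD1 f)//= lerDl sumr_ge0// => g _.
  by apply: prodr_ge0 => m _; exact: W0.
- apply: integrableZl; first exact: measurable_pos.
  apply/integrableP; split.
    exact: mwh.
  apply: le_lt_trans (fin N); rewrite le_eqVlt; apply/orP; left; apply/eqP.
  apply: eq_integral => u; rewrite inE => /posP u0.
  by rewrite gee0_abs// lee_fin mulr_ge0 ?w0 ?h_ge0.
Qed.

Lemma cvg_integral_cells :
  (forall N, (\int[leb]_(u in `]0%R, +oo[) (w u * h N u)%:E < +oo)%E) ->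
  (\int[leb]_(u in `]0%R, +oo[) (w u * h N u)%:E @[N --> \oo] -->
   \int[leb]_(u in `]0%R, +oo[) (w u * hlim u)%:E)%E.
Proof.
move=> fin.
apply: (@dominated_cvg _ _ _ leb D measurable_pos _ _
  (fun u => (w u * \prod_m G m u)%:E)).
- by move=> N; exact: mwh.
- move=> u /posP u0; apply: cvg_EFin; first exact: nearW.
  by apply: cvgMr; exact: cvg_h.
- by [].
- exact: integrable_dominating.
- move=> N u /posP u0.
  have wh0 : 0 <= w u * h N u by apply: mulr_ge0; [exact: w0|exact: h_ge0].
  by rewrite /= lee_fin ger0_norm// ler_wpM2l ?h_le//; exact: w0.
Qed.

End eppf_limit.

(** * Expansion of the limit into the stated integrals *)

Section eppf_formula.
Context {R : realType} (rho : R -> R).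
Hypothesis rho_meas : measurable_fun (`]0, +oo[%classic : set R) rho.
Hypothesis rho_ge0 : forall s, 0 < s -> 0 <= rho s.
Hypothesis rho_fin : (\int[lebesgue_measure]_(s in `]0%R, +oo[)
                  (Num.min 1 s * rho s)%:E < +oo)%E.
Context (zeta c : R) (k n : nat) (ns : 'I_k -> nat).
Hypothesis zeta_gt0 : 0 < zeta.
Hypothesis zeta_lt1 : zeta < 1.
Hypothesis c_gt0 : 0 < c.
Hypothesis ns_gt0 : forall m, (0 < ns m)%N.

Local Notation D := (`]0, +oo[%classic : set R).
Local Notation leb := (@lebesgue_measure R).

Let w u := u ^+ (n - 1) * expR (- (c * psi rho u)).

Let w0 u : 0 < u -> 0 <= w u.
Proof. by move=> u0; rewrite mulr_ge0 ?expR_ge0// exprn_ge0// ltW. Qed.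

Let mw : measurable_fun D w.
Proof.
apply: measurable_funM; first exact: measurable_funX.
apply: measurableT_comp => //; apply: measurableT_comp => //.
by apply: measurable_funM => //; exact: measurable_psi.
Qed.

Let mtau m : measurable_fun D (tau rho (ns m)).
Proof. by rewrite -(prednK (ns_gt0 m)); exact: measurable_tau. Qed.

Let F l i u := w u * bell rho (ns l) i u * \prod_(m | m != l) tau rho (ns m) u.

Let F0 l i u : 0 < u -> 0 <= F l i u.
Proof.
move=> u0; apply: mulr_ge0.
  by apply: mulr_ge0; [exact: w0|exact: bell_ge0].
by apply: prodr_ge0 => m _; exact: tau_ge0.
Qed.

Let mF l i : measurable_fun D (F l i).
Proof.
apply: measurable_funM.
  by apply: measurable_funM; [exact: mw|exact: measurable_bell].
have -> : (fun u => \prod_(m | m != l) tau rho (ns m) u) =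
    fun u => \prod_(m <- [seq m <- index_enum 'I_k | m != l]) tau rho (ns m) u.
  by apply/funext => u; rewrite big_filter.
by apply: measurable_prod => m _; exact: mtau.
Qed.

Let F1 u := w u * \prod_m tau rho (ns m) u.

Let F10 u : 0 < u -> 0 <= F1 u.
Proof.
move=> u0; apply: mulr_ge0; first exact: w0.
by apply: prodr_ge0 => m _; exact: tau_ge0.
Qed.

Let mF1 : measurable_fun D F1.
Proof.
apply: measurable_funM; first exact: mw.
by apply: measurable_prod => m _; exact: mtau.
Qed.

Let A0 := c ^+ k * (1 - zeta) ^+ k.
Let A1 := c ^+ (k - 1) * (1 - zeta) ^+ (k - 1).

Let A0_ge0 : 0 <= A0.
Proof. by rewrite mulr_ge0// exprn_ge0// ?subr_ge0 ltW. Qed.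

Let A1_ge0 : 0 <= A1.
Proof. by rewrite mulr_ge0// exprn_ge0// ?subr_ge0 ltW. Qed.

Let czi_ge0 i : 0 <= c ^+ i * zeta ^+ i.
Proof. by rewrite mulr_ge0// exprn_ge0// ltW. Qed.

(** Blocks are nonempty, so the term [i = 0] vanishes; this is why the inner sum of the formula
    starts at 1. *)
Let bell_gen_pos m a u : 0 < u ->
  bell_gen rho (ns m) a u = \sum_(1 <= i < (ns m).+1) a ^+ i * bell rho (ns m) i u.
Proof.
move=> u0; case: (ns m) (ns_gt0 m) => // j _.
by rewrite /bell_gen big_ord_recl/= bellS0// mulr0 add0r big_add1 big_mkord.
Qed.

Lemma sum_integral_cells (J : finType) (p : J -> R) (g : R) : 0 <= g ->
    (forall j, 0 <= p j) ->
  (\sum_(f : {ffun 'I_k -> J} | injectiveb f)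
     g%:E * \int[leb]_(u in `]0%R, +oo[) (u ^+ (n - 1) * expR (- (c * psi rho u)) *
       \prod_m bell_gen rho (ns m) (c * p (f m)) u)%:E =
   g%:E * \int[leb]_(u in `]0%R, +oo[) (u ^+ (n - 1) * expR (- (c * psi rho u)) *
     \sum_(f : {ffun 'I_k -> J} | injectiveb f)
       \prod_m bell_gen rho (ns m) (c * p (f m)) u)%:E)%E.
Proof.
move=> g0 p0; pose h (f : {ffun 'I_k -> J}) u :=
  w u * \prod_m bell_gen rho (ns m) (c * p (f m)) u.
have h0 f u : D u -> (0 <= (h f u)%:E)%E.
  move=> /posP u0; rewrite lee_fin mulr_ge0 ?w0// prodr_ge0// => m _.
  by apply: bell_gen_ge0 => //; rewrite mulr_ge0// ltW.
have mh f : measurable_fun D (EFin \o h f).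
  apply/measurable_EFinP; apply: measurable_funM; first exact: mw.
  apply: measurable_prod => m _; apply: measurable_sum => i.
  by apply: measurable_funM => //; exact: measurable_bell.
rewrite -ge0_sume_distrr => [|f _]; last first.
  by apply: integral_ge0 => u Du; exact: h0.
congr (_ * _)%E; rewrite -big_filter.
apply: (etrans (esym (ge0_integral_sum leb measurable_pos mh h0 _))).
apply: eq_integral => u _; rewrite sumEFin -mulr_sumr big_filter//.
Qed.

(** All integrands are nonnegative, so sums and constants leave the integral in [\bar R] with no
    finiteness to check. *)
Lemma integral_eppf :
  (\int[leb]_(u in `]0%R, +oo[) (u ^+ (n - 1) * expR (- (c * psi rho u)) *
     (\prod_m ((1 - zeta) * (c * tau rho (ns m) u)) +
      \sum_l bell_gen rho (ns l) (c * zeta) u *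
        \prod_(m | m != l) ((1 - zeta) * (c * tau rho (ns m) u))))%:E =
   (c ^+ k * (1 - zeta) ^+ k)%:E *
      \int[leb]_(u in `]0%R, +oo[)
        (u ^+ (n - 1) * expR (- (c * psi rho u))
           * \prod_(m < k) tau rho (ns m) u)%:E
    + (c ^+ (k - 1) * (1 - zeta) ^+ (k - 1))%:E *
      \sum_(l < k) \sum_(1 <= i < (ns l).+1)
        (c ^+ i * zeta ^+ i)%:E *
        \int[leb]_(u in `]0%R, +oo[)
          (u ^+ (n - 1) * expR (- (c * psi rho u)) * xi rho (ns l) i u
             * \prod_(m < k | m != l) tau rho (ns m) u)%:E)%E.
Proof.
transitivity (\int[leb]_(u in `]0%R, +oo[) (A0%:E * (F1 u)%:E + A1%:E *
    \sum_(l < k) \sum_(1 <= i < (ns l).+1) (c ^+ i * zeta ^+ i)%:E * (F l i u)%:E))%E.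
  apply: eq_integral => u; rewrite inE => /posP u0.
  transitivity ((A0 * F1 u + A1 * \sum_(l < k) \sum_(1 <= i < (ns l).+1)
      (c ^+ i * zeta ^+ i) * F l i u)%:E)%E; last first.
    rewrite EFinD !EFinM -sumEFin; congr (_ + _ * _)%E.
    apply: eq_bigr => l _; rewrite -sumEFin; apply: eq_bigr => i _.
    by rewrite EFinM.
  congr EFin; rewrite -/(w u) mulrDr; congr (_ + _).
    rewrite !big_split/= !prodr_const card_ord /F1 /A0; ring.
  rewrite !mulr_sumr; apply: eq_bigr => l _.
  rewrite !big_split/= !prodr_const.
  have -> : #|[pred m : 'I_k | m != l]| = (k - 1)%N.
    by rewrite subn1 -[in RHS](card_ord k) -(cardC1 l); apply: eq_card.
  rewrite bell_gen_pos// mulr_suml !mulr_sumr; apply: eq_bigr => i _.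
  by rewrite /F exprMn /A1; ring.
have mS l : measurable_fun D (fun u =>
    \sum_(1 <= i < (ns l).+1) (c ^+ i * zeta ^+ i)%:E * (F l i u)%:E)%E.
  apply: emeasurable_sum => i; apply: measurable_funeM.
  by apply/measurable_EFinP; exact: mF.
have S0 l u : 0 < u ->
    (0 <= \sum_(1 <= i < (ns l).+1) (c ^+ i * zeta ^+ i)%:E * (F l i u)%:E)%E.
  by move=> u0; apply: sume_ge0 => i _; rewrite mule_ge0// lee_fin// F0.
rewrite ge0_integralD//; first last.
- apply: measurable_funeM; exact: emeasurable_sum.
- move=> u /posP u0; rewrite mule_ge0 ?lee_fin//.
  by apply: sume_ge0 => l _; exact: S0.
- by apply: measurable_funeM; exact/measurable_EFinP.
- by move=> u /posP u0; rewrite mule_ge0 ?lee_fin// F10.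
rewrite ge0_integralZl_EFin//; first last.
- exact/measurable_EFinP.
- by move=> u /posP u0; rewrite lee_fin F10.
congr (_ + _)%E.
rewrite ge0_integralZl_EFin//; first last.
- exact: emeasurable_sum.
- by move=> u /posP u0; apply: sume_ge0 => l _; exact: S0.
congr (_ * _)%E; rewrite ge0_integral_sum//; last first.
  by move=> l u /posP u0; exact: S0.
apply: eq_bigr => l _; rewrite ge0_integral_sum//; first last.
- by move=> i u /posP u0; rewrite mule_ge0 ?lee_fin// F0.
- by move=> i; apply: measurable_funeM; apply/measurable_EFinP; exact: mF.
(* The bound [i <= ns l] is extracted from the range: it is what identifies [bell] with [xi]. *)
rewrite !big_nat; apply: eq_bigr => i /andP[_ il].
rewrite ge0_integralZl_EFin//; first last.
- by apply/measurable_EFinP; exact: mF.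
- by move=> u /posP u0; rewrite lee_fin F0.
congr (_ * _)%E; apply: eq_integral => u _.
by rewrite xi_bell.
Qed.

End eppf_formula.

Theorem theorem1 (R : realType) (X : ptopologicalType) (X_polish : polish R X)
    (rho : R -> R)
    (rho_meas : measurable_fun (`]0, +oo[%classic : set R) rho)
    (rho_ge0 : forall s, 0 < s -> 0 <= rho s)
    (rho_fin : (\int[lebesgue_measure]_(s in `]0%R, +oo[)
                  (Num.min 1 s * rho s)%:E < +oo)%E)
    (rho_inf : (\int[lebesgue_measure]_(s in `]0%R, +oo[) (rho s)%:E = +oo)%E)
    (zeta c : R) (zeta_gt0 : 0 < zeta) (zeta_lt1 : zeta < 1) (c_gt0 : 0 < c)
    (x0 : X) (Pstar P0 : probability (borel X) R)
    (Pstar_diffuse : forall x : X, Pstar [set x] = 0%E)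
    (P0_def : forall A : set (borel X), measurable A ->
       P0 A = (zeta%:E * \d_(x0 : borel X) A + (1 - zeta)%:E * Pstar A)%E)
    (d : measure_display) (Omega : measurableType d) (P : probability Omega R)
    (Pt : {RV P >-> pprobability (borel X) R})
    (Pt_law : hNRMI rho c P0 (distribution P Pt))
    (n : nat) (n_gt0 : (0 < n)%N)
    (Y : 'I_n -> {RV P >-> borel X})
    (Y_iid : conditionally_iid P Pt (fun a => Y a : Omega -> borel X))
    (k : nat) (k_gt0 : (0 < k)%N)
    (ns : 'I_k -> nat) (ns_gt0 : forall m, (0 < ns m)%N)
    (ns_sum : (\sum_(m < k) ns m = n)%N)
    (pi : {set {set 'I_n}}) (pi_partition : finset.partition pi [set: 'I_n]%SET)
    (pi_sizes : perm_eq [seq #|B : {set 'I_n}| | B in pi]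
                        [seq ns m | m : 'I_k]) :
  P [set w | tie_partition (fun a => Y a w : X) = pi] =
  ((Gamma (n%:R : R))^-1%:E *
   ((c ^+ k * (1 - zeta) ^+ k)%:E *
      \int[lebesgue_measure]_(u in `]0%R, +oo[)
        (u ^+ (n - 1) * expR (- (c * psi rho u))
           * \prod_(m < k) tau rho (ns m) u)%:E
    + (c ^+ (k - 1) * (1 - zeta) ^+ (k - 1))%:E *
      \sum_(l < k) \sum_(1 <= i < (ns l).+1)
        (c ^+ i * zeta ^+ i)%:E *
        \int[lebesgue_measure]_(u in `]0%R, +oo[)
          (u ^+ (n - 1) * expR (- (c * psi rho u)) * xi rho (ns l) i u
             * \prod_(m < k | m != l) tau rho (ns m) u)%:E))%E.
Proof.
have [U U_open U_sep] := polish_separating X_polish.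
have [b [b_card b_tie]] := partition_labelling pi_partition pi_sizes.
have b_surj m : exists a, b a = m.
  have : (0 < #|[pred a | b a == m]|)%N by rewrite b_card.
  by move=> /card_gt0P[a]; rewrite inE => /eqP; exists a.
pose q N o := @cell_prob R X U x0 Pstar N o.
have pE N o : fine (P0 (cell U x0 N @^-1` [set o])) =
    zeta * (o == None)%:R + (1 - zeta) * q N o.
  rewrite P0_def; last exact: measurable_cell.
  rewrite -(cell_probE U_open U_sep) diracE -EFinM -EFinD /=; congr (_ * _%:R + _).
  congr nat_of_bool; apply/idP/eqP; rewrite inE /= /cell eqxx; first by move=> <-.
  by move=> ->.
have G_gt0 : 0 < (Gamma (n%:R : R))^-1 by rewrite invr_gt0 -(prednK n_gt0) GammaE ltr0n fact_gt0.
have g0 := ltW G_gt0.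
have PN N : P [set w | forall a a',
      (cell U x0 N (Y a w) == cell U x0 N (Y a' w)) = (b a == b a')] =
    ((Gamma (n%:R : R))^-1%:E * \int[lebesgue_measure]_(u in `]0%R, +oo[)
      (u ^+ (n - 1) * expR (- (c * psi rho u)) *
        \sum_(f : {ffun 'I_k -> option {ffun 'I_N -> bool}} | injectiveb f)
          \prod_m bell_gen rho (ns m)
            (c * (zeta * (f m == None)%:R + (1 - zeta) * q N (f m))) u)%:E)%E.
  rewrite (tie_partition_cells rho_meas rho_ge0 rho_fin rho_inf c_gt0 Pt_law n_gt0
    Y_iid (fun o => measurable_cell U_open U_sep x0 o) b_surj).
  have p_ge0 (o : option {ffun 'I_N -> bool}) :
      0 <= zeta * (o == None)%:R + (1 - zeta) * q N o.
    by rewrite addr_ge0 ?mulr_ge0 ?subr_ge0 ?(ltW zeta_gt0) ?(ltW zeta_lt1)// cell_prob_ge0.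
  rewrite -(sum_integral_cells rho_meas rho_ge0 rho_fin n ns c_gt0 g0 p_ge0).
  apply: eq_bigr => f _; congr (_ * _)%E; apply: eq_integral => u _.
  by congr ((_ * _)%:E); apply: eq_bigr => m _; rewrite b_card pE.
(* The integral at level [N] is a probability divided by a positive constant, hence finite;
   domination starts from this. *)
have fin N : (\int[lebesgue_measure]_(u in `]0%R, +oo[)
      (u ^+ (n - 1) * expR (- (c * psi rho u)) *
        \sum_(f : {ffun 'I_k -> option {ffun 'I_N -> bool}} | injectiveb f)
          \prod_m bell_gen rho (ns m)
            (c * (zeta * (f m == None)%:R + (1 - zeta) * q N (f m))) u)%:E < +oo)%E.
  rewrite ltey; apply/eqP => I_oo.
  have := probability_le1 P (measurable_cell_tie U_open U_sep x0 Y b N).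
  by rewrite PN I_oo mulry gtr0_sg// mul1e leye_eq.
rewrite -(integral_eppf rho_meas rho_ge0 rho_fin n zeta_gt0 zeta_lt1 c_gt0 ns_gt0).
rewrite (_ : [set w | _] =
    [set w | forall a a', ((Y a w : X) == Y a' w) = (b a == b a')]); last first.
  by apply/seteqP; split => w /b_tie.
have lim1 := @cvg_cell_tie R X U U_open U_sep x0 d Omega P n k Y b.
have zeta01 : 0 < zeta < 1 by rewrite zeta_gt0.
have lim2 := cvg_integral_cells (o0 := fun N => None) (q := q) rho_meas rho_ge0 rho_fin
  (fun N o => cell_prob_ge0 U x0 Pstar o) (cell_prob_None U x0 Pstar_diffuse)
  (sum_cell_prob U_open U_sep x0 Pstar)
  (cvg_sum_cell_prob2 U_open U_sep x0 Pstar_diffuse) zeta01 c_gt0 ns_gt0 fin.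
(* One sequence, two limits: the probabilities of the cell ties tend to that of the true ties, and
   their integral form tends to the formula. *)
move: lim1; under eq_fun do rewrite PN.
move=> /(cvg_unique _); apply => //.
by apply: cvgeZl lim2.
Qed.
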